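(* Let $A:D(A)\to2^X\setminus\{\emptyset\}$ be $m$-$T$-accretive in the Banach lattice $X$, let $I=[t_0,t_1]$, and let $K:I\to2^X$, with $K_A(t):=K(t)\cap\overline{D(A)}$, satisfy $x,y\in K_A(t)\Rightarrow x\vee y\in K_A(t)$ for every $t\in I$. Let $f:\mathrm{gr}(K_A)\to X$ be locally Lipschitz in the state variable and suppose that $f(t,\cdot)$ is quasimonotone on $K_A(t)$ for almost every $t\in I$. Let $u$ and $v$ be mild solutions on $I$ of $z'+Az\ni f(t,z)$ such that $u(t),v(t)\in K_A(t)$ for every $t\in I$. If $u(t_0)\le v(t_0)$, then $u(t)\le v(t)$ for every $t\in I$.
   Context: $X$ is a real Banach lattice with positive cone $X_+$; $x^+=x\vee0$. A (possibly multivalued) operator $A$ is accretive if $\|x-\bar x\|\le\|x-\bar x+\lambda(y-\bar y)\|$ for all $\lambda>0$, $y\in Ax$, $\bar y\in A\bar x$; $m$-accretive if in addition $R(I+\lambda A)=X$ for all $\lambda>0$; $T$-accretive if $\|(x-\bar x)^+\|\le\|(x-\bar x+\lambda(y-\bar y))^+\|$ for all such data; $m$-$T$-accretive if both $m$-accretive and $T$-accretive. For $x\in\overline{D(A)}$ and $w\in L^1([s,b];X)$, the mild solution of $u'+Au\ni w$, $u(s)=x$ is the unique $u\in C([s,b];X)$ such that for every $\varepsilon>0$ there are a partition $s=t_0<\dots<t_N=b$ of mesh $<\varepsilon$, vectors $w_k\in X$ with $\sum_k\int_{t_{k-1}}^{t_k}\|w(t)-w_k\|\,dt<\varepsilon$,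 and $v_0=x$, $(v_k-v_{k-1})/(t_k-t_{k-1})+Av_k\ni w_k$, such that $u$ is uniformly within $\varepsilon$ of the step function equal to $v_k$ on $(t_{k-1},t_k]$ (and $x$ at $s$). A mild solution on $I$ of $z'+Az\ni f(t,z)$ in the tube is a continuous $z$ with $z(t)\in K_A(t)$, $f(\cdot,z(\cdot))\in L^1(I;X)$, which is the mild solution with forcing $w=f(\cdot,z(\cdot))$. $\mathrm{gr}(K_A)=\{(t,x):t\in I,\ x\in K_A(t)\}$. $f$ is locally Lipschitz in the state variable if for every $x_0\in X$ there are $r>0$ and $0\le\omega\in L^1(I)$ such that $\|f(t,x)-f(t,y)\|\le\omega(t)\|x-y\|$ for a.e. $t$ and all $x,y\in K_A(t)\cap\overline B_r(x_0)$. A map $F:D\subset X\to X$ is quasimonotone (with respect to $X_+$) if $\lim_{h\downarrow0}h^{-1}d(y-x+h(F(y)-F(x)),X_+)=0$ for all $x,y\in D$ with $x\le y$. *)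

(* Defs.v *)
From HB Require Import structures.
From mathcomp Require Import all_boot all_order all_algebra.
From mathcomp Require Import all_classical all_reals all_analysis.

Set Implicit Arguments.
Unset Strict Implicit.
Unset Printing Implicit Defensive.

Import Order.TTheory GRing.Theory Num.Theory.
Import numFieldNormedType.Exports.

Local Open Scope classical_set_scope.
Local Open Scope ring_scope.

(* The lattice order is carried by operations of its own rather than by
   [Order.Lattice]: the hierarchy has no joint ancestor of [Order.POrder] and
   the normed modules below the numeric domains, so no structure can inherit
   from both. [vjoin] is the binary supremum; binary infima need no operation,
   being [- vjoin (- x) (- y)]. [`|x|] is always the norm, and the modulus of
   [x] is [vjoin x (- x)]. *)
HB.mixin Record isBanachLattice (R : realType) X
    of CompleteNormedModule R X := {
  vle : rel X ;
  vjoin : X -> X -> X ;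
  vle_refl : reflexive vle ;
  vle_anti : antisymmetric vle ;
  vle_trans : transitive vle ;
  vle_joinl : forall x y, vle x (vjoin x y) ;
  vle_joinr : forall x y, vle y (vjoin x y) ;
  vjoin_le : forall x y z, vle x z -> vle y z -> vle (vjoin x y) z ;
  vle_add2r : forall x y z, vle x y -> vle (x + z) (y + z) ;
  vle_scale : forall (a : R) x y, 0 <= a -> vle x y -> vle (a *: x) (a *: y) ;
  vle_norm : forall x y,
    vle (vjoin x (- x)) (vjoin y (- y)) -> `|x| <= `|y|
}.

#[short(type="banachLatticeType")]
HB.structure Definition BanachLattice (R : realType) :=
  { X of isBanachLattice R X & CompleteNormedModule R X }.

Section banach_lattice.
Context {R : realType} {X : banachLatticeType R}.

Definition pospart (x : X) : X := vjoin x 0.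

Definition pos_cone : set X := [set x | vle 0 x].

Definition quasimonotone (D : set X) (F : X -> X) : Prop :=
  forall x y, D x -> D y -> vle x y ->
    (h^-1%:E * edist_inf pos_cone (y - x + h *: (F y - F x))%R)%E
      @[h --> 0^'+] --> 0%E.

End banach_lattice.

(* A multivalued operator is its graph map [A : X -> set X], with domain the
   set of points where it is nonempty. *)
Section accretive.
Context {R : realType}.

Definition op_dom (X : Type) (A : X -> set X) : set X := [set x | A x !=set0].

Definition accretive (X : normedModType R) (A : X -> set X) : Prop :=
  forall (lambda : R) (x x' y y' : X), 0 < lambda -> A x y -> A x' y' ->
    `|x - x'| <= `|x - x' + lambda *: (y - y')|.

Definition m_accretive (X : normedModType R) (A : X -> set X) : Prop :=
  accretive A /\
  forall lambda : R, 0 < lambda ->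
    forall z : X, exists x y, A x y /\ x + lambda *: y = z.

Definition T_accretive (X : banachLatticeType R) (A : X -> set X) : Prop :=
  forall (lambda : R) (x x' y y' : X), 0 < lambda -> A x y -> A x' y' ->
    `|pospart (x - x')| <= `|pospart (x - x' + lambda *: (y - y'))|.

Definition m_T_accretive (X : banachLatticeType R) (A : X -> set X) : Prop :=
  m_accretive A /\ T_accretive A.

End accretive.

Section mild_solutions.
Context {R : realType} {X : completeNormedModType R}.
Local Notation mu := (@lebesgue_measure R).

Definition simple_function (s : R -> X) : Prop :=
  finite_set (range s) /\ forall x, measurable (s @^-1` [set x]).

Definition ae_strongly_measurable (D : set R) (w : R -> X) : Prop :=
  exists s : nat -> R -> X, (forall n, simple_function (s n)) /\
    {ae mu, forall t, D t -> s n t @[n --> \oo] --> w t}.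

(* [mu] lives on the Borel sets, so [`|w t|] need only agree almost everywhere
   with a measurable function; for nonnegative integrands the library integral
   is a supremum over simple minorants, which gives the right value then. *)
Definition bochner_integrable (D : set R) (w : R -> X) : Prop :=
  ae_strongly_measurable D w /\ (\int[mu]_(t in D) `|w t|%:E < +oo)%E.

(* [v] is a step function approximation, at accuracy [eps], of a solution of
   [u' + A u \ni w] on [[s, b]] with initial value [x], and [u] is uniformly
   [eps]-close to it. *)
Definition eps_approximable (A : X -> set X) (s b : R) (w : R -> X) (x : X)
    (u : R -> X) (eps : R) : Prop :=
  exists (N : nat) (t : nat -> R) (wk v : nat -> X),
    [/\ [/\ t 0%N = s, t N = b & forall k, (k < N)%N ->
              t k < t k.+1 /\ t k.+1 - t k < eps],
        (\sum_(k < N) \int[mu]_(tau in `[t k, t k.+1]) `|w tau - wk k.+1|%:E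
            < eps%:E)%E,
        v 0%N = x,
        forall k, (k < N)%N ->
          A (v k.+1) (wk k.+1 - (t k.+1 - t k)^-1 *: (v k.+1 - v k)) &
        `|u s - x| <= eps /\
        forall k tau, (k < N)%N -> t k < tau <= t k.+1 ->
          `|u tau - v k.+1| <= eps].

Definition mild_solution (A : X -> set X) (s b : R) (w : R -> X) (x : X)
    (u : R -> X) : Prop :=
  [/\ closure (op_dom A) x, bochner_integrable `[s, b] w,
      {within `[s, b], continuous u} &
      forall eps : R, 0 < eps -> eps_approximable A s b w x u eps].

(* The tube [K_A]. *)
Definition tube (A : X -> set X) (K : R -> set X) (t : R) : set X :=
  K t `&` closure (op_dom A).

(* [f] and [K] are total functions; only [f t x] for [t0 <= t <= t1] and
   [x] in [tube A K t] is ever constrained. *)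
Definition mild_solution_in_tube (A : X -> set X) (K : R -> set X) (t0 t1 : R)
    (f : R -> X -> X) (z : R -> X) : Prop :=
  [/\ {within `[t0, t1], continuous z},
      forall t, t \in `[t0, t1] -> tube A K t (z t),
      bochner_integrable `[t0, t1] (fun t => f t (z t)) &
      mild_solution A t0 t1 (fun t => f t (z t)) (z t0) z].

Definition locally_lipschitz_in_state (A : X -> set X) (K : R -> set X)
    (t0 t1 : R) (f : R -> X -> X) : Prop :=
  forall x0 : X, exists (r : R) (omega : R -> R),
    [/\ 0 < r, forall t, t \in `[t0, t1] -> 0 <= omega t,
        mu.-integrable `[t0, t1] (EFin \o omega) &
        {ae mu, forall t, t \in `[t0, t1] -> forall x y,
          (tube A K t `&` closed_ball x0 r) x ->
          (tube A K t `&` closed_ball x0 r) y ->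
          `|f t x - f t y| <= omega t * `|x - y|}].

End mild_solutions.

(* Main.v *)
Require Import Defs.
From mathcomp Require Import all_boot all_order all_algebra.
From mathcomp Require Import all_classical all_reals all_analysis.
From mathcomp Require Import measurable_realfun ring lra.
Set Implicit Arguments.
Unset Strict Implicit.
Unset Printing Implicit Defensive.
Import Order.TTheory GRing.Theory Num.Theory.
Import numFieldNormedType.Exports.
Local Open Scope classical_set_scope.
Local Open Scope ring_scope.

(* Write [N x] for the norm of the positive part of [x] and, for [h > 0],
   [[p, q]_h = (N (p + h q) - N p) / h]. Two implicit Euler schemes with step
   sizes [d] and [d'] satisfy, by T-accretivity, the difference inequality
   [(a_kl - a_(k-1)l) / d + (a_kl - a_k(l-1)) / d' <= [x_k - y_l, w_k - w'_l]_h]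
   for [a_kl = N (x_k - y_l)]. A discrete maximum principle with a quadratic
   penalty off the diagonal, applied on short intervals with the forcings nearly
   constant, and summation over fine partitions give
   [N (u b - v b) <= N (u a - v a) + \int_a^b [u - v, f u - f v]_h]
   for every [h > 0]. With [p = u \/ v] in the tube, quasimonotonicity for
   [u <= p] gives [(u - v) + h (f u - f v) <= (u - v)^+ + h (f p - f v) + o(h)],
   and [p - v = (u - v)^+], so the bracket is at most [omega N (u - v) + o(1)]
   near a point where [N (u - v)] vanishes. Letting [h] tend to [0], a
   Gronwall argument shows that the set where [N (u - v) = 0], which is closed
   and contains [t0], extends to the right of each of its points. *)

(** * The norm of the positive part *)

Section positive_part_norm.
Context {R : realType} {X : banachLatticeType R}.
Implicit Types (x y z q : X) (a : R).

Lemma vleD x y z q : vle x y -> vle z q -> vle (x + z) (y + q).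
Proof.
move=> xy zq; apply: (vle_trans (y + z)); first exact: vle_add2r.
by rewrite ![y + _]addrC; apply: vle_add2r.
Qed.

Lemma vle_opp x y : vle x y -> vle (- y) (- x).
Proof.
by move=> /vle_add2r -/(_ (- x - y)); rewrite addrA subrr add0r addrCA subrr addr0.
Qed.

Lemma modulus_ge0 x : vle 0 (vjoin x (- x)).
Proof.
have := vleD (vle_joinl x (- x)) (vle_joinr x (- x)); rewrite subrr.
have h : 0 <= 1 / 2 :> R by rewrite divr_ge0.
move/(vle_scale _ _ _ h); by rewrite scaler0 scalerDr -scalerDl -splitr scale1r.
Qed.

Lemma pospart_ge0 x : vle 0 (pospart x).
Proof. exact: vle_joinr. Qed.

Lemma vle_pospart x : vle x (pospart x).
Proof. exact: vle_joinl. Qed.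

Lemma vle_norm_ge0 x y : vle 0 x -> vle x y -> `|x| <= `|y|.
Proof.
move=> x0 xy; apply: vle_norm; apply: (vle_trans y); last exact: vle_joinl.
apply: vjoin_le => //; apply: (vle_trans 0); last exact: vle_trans xy.
by rewrite -oppr0; exact: vle_opp.
Qed.

Definition posnorm x : R := `|pospart x|.

Lemma posnorm_ge0 x : 0 <= posnorm x.
Proof. exact: normr_ge0. Qed.

Lemma posnorm_le_norm x : posnorm x <= `|x|.
Proof.
apply: vle_norm; apply: (vle_trans (pospart x)).
  apply: vjoin_le; first exact: vle_refl.
  apply: (vle_trans 0); last exact: pospart_ge0.
  by rewrite -oppr0; apply: vle_opp; exact: pospart_ge0.
by apply: vjoin_le; [exact: vle_joinl|exact: modulus_ge0].
Qed.

Lemma posnormD x y : posnorm (x + y) <= posnorm x + posnorm y.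
Proof.
apply: le_trans (ler_normD _ _); apply: vle_norm_ge0; first exact: pospart_ge0.
apply: vjoin_le; first by apply: vleD; exact: vle_pospart.
by rewrite -[0]addr0; apply: vleD; exact: pospart_ge0.
Qed.

Lemma posnormZ a x : 0 <= a -> posnorm (a *: x) <= a * posnorm x.
Proof.
move=> a0; rewrite -{2}(ger0_norm a0) -normrZ.
apply: vle_norm_ge0; first exact: pospart_ge0.
apply: vjoin_le; first by apply: vle_scale => //; exact: vle_pospart.
by rewrite -(scaler0 _ a); apply: vle_scale => //; exact: pospart_ge0.
Qed.

Lemma posnorm_le_dist x y : posnorm x <= posnorm y + `|x - y|.
Proof.
rewrite -{1}(subrK y x) addrC; apply: le_trans (posnormD _ _) _.
by rewrite lerD2l posnorm_le_norm.
Qed.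

Lemma posnorm_eq0 x : posnorm x = 0 <-> vle x 0.
Proof.
split=> [/eqP|x0].
  by rewrite normr_eq0 => /eqP <-; exact: vle_pospart.
have -> : posnorm x = `|0 : X|; last by rewrite normr0.
congr `|_|; apply: vle_anti; rewrite pospart_ge0 andbT.
by apply: vjoin_le => //; exact: vle_refl.
Qed.

Lemma vle_posnormB (x y : X) : vle x y <-> posnorm (x - y) = 0.
Proof.
rewrite posnorm_eq0; split=> [/vle_add2r-/(_ (- y))|/vle_add2r-/(_ y)].
  by rewrite subrr.
by rewrite subrK add0r.
Qed.

(** Translation invariance of the order. The identity turns the join of the two solutions, at which
    quasimonotonicity is tested, into the positive part of their difference. *)
Lemma vjoinBr x y : vjoin x y - y = pospart (x - y).
Proof.
apply: vle_anti; apply/andP; split.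
  rewrite -[pospart _](addrK y); apply: vle_add2r; apply: vjoin_le.
    by rewrite -{1}(subrK y x); apply: vle_add2r; exact: vle_pospart.
  by rewrite -{1}[y]add0r; apply: vle_add2r; exact: pospart_ge0.
apply: vjoin_le; first by apply: vle_add2r; exact: vle_joinl.
by rewrite -(subrr y); apply: vle_add2r; exact: vle_joinr.
Qed.

End positive_part_norm.

(** * Implicit Euler schemes *)

Section discrete_scheme.
Context {R : realType} {X : banachLatticeType R}.

Lemma posnormB_le (x y x' y' : X) :
  posnorm (x - y) <= posnorm (x' - y') + `|x - x'| + `|y - y'|.
Proof.
apply: le_trans (posnorm_le_dist _ (x' - y')) _.
rewrite -[leRHS]addrA lerD2l.
have -> : x - y - (x' - y') = x - x' - (y - y').
  by rewrite !opprB [y' - x']addrC addrACA [- y + y']addrC.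
exact: ler_normB.
Qed.

(* The step in the proof is chosen to make the coefficient of [posnorm (x - y)]
   on the right of the subadditivity estimate vanish. *)
Lemma T_accretive_step (A : X -> set X) (x x' w y y' w' : X) (d d' h : R) :
  T_accretive A -> 0 < d -> 0 < d' -> 0 < h ->
  A x (w - d^-1 *: (x - x')) -> A y (w' - d'^-1 *: (y - y')) ->
  (posnorm (x - y) - posnorm (x' - y)) / d +
  (posnorm (x - y) - posnorm (x - y')) / d' <=
  (posnorm (x - y + h *: (w - w')) - posnorm (x - y)) / h.
Proof.
move=> hA d0 d'0 h0 Ax Ay.
have S0 : 0 < d^-1 + d'^-1 + h^-1 by rewrite !addr_gt0 ?invr_gt0.
have Si0 : 0 < (d^-1 + d'^-1 + h^-1)^-1 by rewrite invr_gt0.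
have := hA _ _ _ _ _ Si0 Ax Ay; rewrite -/(posnorm _) -/(posnorm _).
set S := d^-1 + d'^-1 + h^-1 in S0 Si0 *.
have -> : x - y + S^-1 *: (w - d^-1 *: (x - x') - (w' - d'^-1 *: (y - y'))) =
    S^-1 *: (d^-1 *: (x' - y) + d'^-1 *: (x - y')
      + h^-1 *: (x - y + h *: (w - w'))).
  rewrite -[x - y in LHS](scalerK (lt0r_neq0 S0)) -scalerDr; congr (_ *: _).
  rewrite /S !scalerDl opprB (AC (3*(2*2)) ((1*5)*(2*6)*(3*(4*7)))) /=.
  rewrite -!scalerBr -scalerDr opprB; congr (_ + _ + _).
  - by congr (_ *: _); rewrite addrC addrA subrK addrC.
  - by congr (_ *: _); rewrite addrA subrK.
  - by rewrite [RHS]scalerDr scalerA mulVf ?scale1r// gt_eqF.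
move=> /le_trans/(_ (posnormZ _ (ltW Si0))).
rewrite mulrC ler_pdivlMr// => /le_trans/(_ (posnormD _ _)).
move=> /le_trans/(_ (lerD (posnormD _ _) (lexx _))).
have dn0 : 0 <= d^-1 by rewrite invr_ge0 ltW.
have d'n0 : 0 <= d'^-1 by rewrite invr_ge0 ltW.
have hn0 : 0 <= h^-1 by rewrite invr_ge0 ltW.
move=> /le_trans/(_ (lerD (lerD (posnormZ _ dn0) (posnormZ _ d'n0))
  (posnormZ _ hn0))).
rewrite /S; lra.
Qed.

(** Discrete maximum principle by double induction: if [a] exceeded [B] at [(k.+1, l.+1)] but not at
    the two predecessors, both difference quotients of [a - B] would be positive there. *)
Lemma discrete_comparison (N M : nat) (d d' : nat -> R) (a B : nat -> nat -> R) :
  (forall k, (k < N)%N -> 0 < d k) -> (forall l, (l < M)%N -> 0 < d' l) ->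
  (forall k l, (k < N)%N -> (l < M)%N ->
    (a k.+1 l.+1 - a k l.+1) / d k + (a k.+1 l.+1 - a k.+1 l) / d' l <=
    (B k.+1 l.+1 - B k l.+1) / d k + (B k.+1 l.+1 - B k.+1 l) / d' l) ->
  (forall k, (k <= N)%N -> a k 0%N <= B k 0%N) ->
  (forall l, (l <= M)%N -> a 0%N l <= B 0%N l) ->
  forall k l, (k <= N)%N -> (l <= M)%N -> a k l <= B k l.
Proof.
move=> d0 d'0 aB aB0 a0B; elim=> [|k IHk] l kN; first exact: a0B.
elim: l => [|l IHl] lM; first exact: aB0.
have := aB _ _ kN lM; have := IHk l.+1 (ltnW kN) lM; have := IHl (ltnW lM).
have dk : 0 < (d k)^-1 by rewrite invr_gt0 d0.
have dl : 0 < (d' l)^-1 by rewrite invr_gt0 d'0.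
move=> h1 h2 h3; rewrite leNgt; apply/negP => h4.
have := mulr_gt0 dk (_ : 0 < a k.+1 l.+1 - B k.+1 l.+1 + (B k l.+1 - a k l.+1)).
have := mulr_gt0 dl (_ : 0 < a k.+1 l.+1 - B k.+1 l.+1 + (B k.+1 l - a k.+1 l)).
nra.
Qed.

(* [W c x y] stands for the integral of [`|w t - c|] over [[x, y]]. *)
Definition L1_deviation (W : X -> R -> R -> R) (a b : R) :=
  [/\ forall c x y, a <= x -> x <= y -> y <= b -> 0 <= W c x y,
      forall c x y z, a <= x -> x <= y -> y <= z -> z <= b ->
        W c x z = W c x y + W c y z &
      forall c c' x y, a <= x -> x <= y -> y <= b ->
        (y - x) * `|c - c'| <= W c x y + W c' x y].

(* Unlike in [eps_approximable], the nodes need only start and end within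
   [eps] of the endpoints, which makes the notion stable under restriction to
   subintervals. *)
Definition step_scheme (A : X -> set X) (W : X -> R -> R -> R) (u : R -> X)
    (a b eps : R) : Prop :=
  exists (N : nat) (t : nat -> R) (w v : nat -> X),
  [/\ [/\ a <= t 0%N <= a + eps, b - eps <= t N <= b &
        forall k, (k < N)%N -> 0 < t k.+1 - t k <= eps],
      \sum_(k < N) W (w k.+1) (t k) (t k.+1) <= eps,
      forall k, (k <= N)%N -> `|u (t k) - v k| <= eps &
      forall k, (k < N)%N ->
        A (v k.+1) (w k.+1 - (t k.+1 - t k)^-1 *: (v k.+1 - v k))].

Lemma nodes_mono (N : nat) (t : nat -> R) :
  (forall k, (k < N)%N -> t k <= t k.+1) ->
  forall k l, (k <= l)%N -> (l <= N)%N -> t k <= t l.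
Proof.
move=> ht k; elim=> [|l IHl]; first by rewrite leqn0 => /eqP ->.
rewrite leq_eqVlt => /predU1P[->//|kl] lN.
by apply: le_trans (ht _ lN); apply: IHl => //; exact: ltnW.
Qed.

Lemma L1_deviation_nodes (W : X -> R -> R -> R) (a b : R) (c : X) (N : nat)
    (t : nat -> R) :
  L1_deviation W a b -> a <= t 0%N -> t N <= b ->
  (forall k, (k < N)%N -> t k <= t k.+1) ->
  \sum_(k < N) W c (t k) (t k.+1) <= W c a b.
Proof.
move=> [W0 WD _] at0 tNb ht; have tm := nodes_mono ht.
have atk k : (k <= N)%N -> a <= t k by move=> kN; apply: le_trans at0 _; exact: tm.
have tkb k : (k <= N)%N -> t k <= b by move=> kN; apply: le_trans tNb; exact: tm.
have H : forall n, (n <= N)%N -> \sum_(k < n) W c (t k) (t k.+1) <= W c a (t n).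
  elim=> [|n IHn] nN; first by rewrite big_ord0; apply: W0 => //; exact: tkb.
  have nN' := ltnW nN; rewrite big_ord_recr/= (WD _ a (t n)) ?lerD2r ?IHn//.
  - exact: atk.
  - exact: ht.
  - exact: tkb.
apply: le_trans (H _ (leqnn N)) _.
by rewrite (WD _ a (t N) b) ?atk// lerDl; apply: W0; rewrite ?atk.
Qed.

End discrete_scheme.

(** * The estimate on a short interval with frozen forcings *)

Section local_estimate.
Context {R : realType} {X : banachLatticeType R}.

(** The third clause of [L1_deviation] is applied on each step to the constants [w k.+1] and [c]. *)
Lemma step_scheme_forcing (W : X -> R -> R -> R)
    (a b eps : R) (c : X) (N : nat) (t : nat -> R) (w : nat -> X) :
  L1_deviation W a b -> a <= t 0%N -> t N <= b ->
  (forall k, (k < N)%N -> t k <= t k.+1) ->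
  \sum_(k < N) W (w k.+1) (t k) (t k.+1) <= eps ->
  \sum_(k < N) (t k.+1 - t k) * `|w k.+1 - c| <= W c a b + eps.
Proof.
move=> WP at0 tNb ht We; have tm := nodes_mono ht.
apply: le_trans (lerD (L1_deviation_nodes c WP at0 tNb ht) We).
rewrite -big_split/=; apply: ler_sum => k _; rewrite addrC.
case: WP => _ _; apply; last by apply: le_trans tNb; apply: tm.
  by apply: le_trans at0 _; apply: tm => //; exact: ltnW.
exact: ht.
Qed.

(** [posnorm] is 1-Lipschitz. The base point occurs twice in the quotient, hence [2 * d / h], while
    the change of direction carries a factor [h] that cancels. *)
Lemma bracket_le (p q z z' : X) (h d e : R) : 0 < h ->
  `|p - q| <= d -> `|z - z'| <= e ->
  (posnorm (p + h *: z) - posnorm p) / h <=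
  (posnorm (q + h *: z') - posnorm q) / h + 2 * d / h + e.
Proof.
move=> h0 pq zz; rewrite -[e in leRHS](mulfK (lt0r_neq0 h0)) -!mulrDl.
rewrite ler_pM2r ?invr_gt0//.
have h1 : posnorm (p + h *: z) <= posnorm (q + h *: z') + (d + h * e).
  apply: le_trans (posnorm_le_dist _ (q + h *: z')) _; rewrite lerD2l.
  rewrite opprD addrACA -scalerBr; apply: le_trans (ler_normD _ _) _.
  by rewrite lerD// normrZ (gtr0_norm h0) ler_pM2l.
have := posnorm_le_dist q p; rewrite distrC; lra.
Qed.

(** Near the diagonal, [t] and [s] both lie within [rho] of [a], and each of the three terms on the
    left is at most [eta]. Away from it the penalty is at least [theta + g * (b - a)], which pays
    for one increment and the drift; the other increment belongs to the point close to [a] and is at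
    most [eta]. *)
Lemma boundary_bound (a b rho eps eta theta g P t0 t s U V : R) :
  0 <= g -> 0 < rho -> g * rho <= eta -> 0 <= P ->
  P * rho ^+ 2 = 4 * (theta + g * (b - a)) -> eps <= rho / 2 ->
  a <= t0 -> t0 <= t -> t <= b -> a <= s ->
  t - a <= eps \/ s - a <= eps ->
  (t - a <= rho -> U <= eta) -> (s - a <= rho -> V <= eta) ->
  U <= theta -> V <= theta ->
  U + V + g * (t - t0) <= 3 * eta + P * (t - s) ^+ 2.
Proof.
move=> g0 rho0 grho P0 P_rho eps_rho at0 t0t tb as_ near_a Ueta Veta Uth Vth.
have eta0 : 0 <= eta by apply: le_trans grho; rewrite mulr_ge0// ltW.
have [ts|ts] := lerP `|t - s| (rho / 2).
  move: ts; rewrite ler_norml => /andP[ts1 ts2].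
  have ta : t - a <= rho by clear - near_a eps_rho ts1 ts2; case: near_a; lra.
  have sa : s - a <= rho by clear - near_a eps_rho ts1 ts2; case: near_a; lra.
  have : g * (t - t0) <= g * rho.
    by rewrite ler_wpM2l//; apply: le_trans ta; rewrite lerD2l lerN2.
  have : 0 <= P * (t - s) ^+ 2 by rewrite mulr_ge0// sqr_ge0.
  by move: grho (Ueta ta) (Veta sa); clear; lra.
have far : theta + g * (b - a) <= P * (t - s) ^+ 2.
  have : P * (rho / 2) ^+ 2 <= P * (t - s) ^+ 2.
    rewrite ler_wpM2l// -[leRHS]real_normK ?num_real//.
    rewrite ler_sqr ?nnegrE//; first exact: ltW.
    by rewrite divr_ge0// ltW.
  by rewrite expr_div_n mulrA P_rho (_ : 4 * _ / _ = theta + g * (b - a)); [|field].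
have gt : g * (t - t0) <= g * (b - a) by rewrite ler_wpM2l// lerB.
case: near_a => [ka|la].
  have /Ueta : t - a <= rho by move: ka eps_rho rho0; clear; lra.
  by move: far gt Vth eta0; clear; lra.
have /Veta : s - a <= rho by move: la eps_rho rho0; clear; lra.
by move: far gt Uth eta0; clear; lra.
Qed.

(** The contributions of the penalty in the two variables cancel up to the sum of the two step
    sizes, so a fine mesh makes its effect on the difference inequality small. *)
Lemma supersolution_quotients (C G r e r' e' t0 t t' s s' P : R) :
  t' - t != 0 -> s' - s != 0 ->
  (C + G * (t' - t0) + (r + (t' - t) * e) + (r' + (s' - s) * e')
   + P * (t' - s') ^+ 2 -
   (C + G * (t - t0) + r + (r' + (s' - s) * e') + P * (t - s') ^+ 2)) / (t' - t) +
  (C + G * (t' - t0) + (r + (t' - t) * e) + (r' + (s' - s) * e')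
   + P * (t' - s') ^+ 2 -
   (C + G * (t' - t0) + (r + (t' - t) * e) + r' + P * (t' - s) ^+ 2)) / (s' - s) =
  G + e + e' - P * ((t' - t) + (s' - s)).
Proof. by move=> t't s's; field; rewrite s's. Qed.

(** The forcings are replaced by constants at the cost of their deviations, and the base point of
    the bracket is frozen at [a] at a cost of [8 * theta / h] per unit of time. Two schemes are then
    compared with a barrier [B] by [discrete_comparison]. *)
Lemma local_estimate (A : X -> set X) (W W' : X -> R -> R -> R) (u v : R -> X)
    (a b h theta : R) (c c' : X) :
  T_accretive A -> a < b -> 0 < h -> 0 < theta ->
  L1_deviation W a b -> L1_deviation W' a b ->
  (forall eps, 0 < eps -> step_scheme A W u a b eps) ->
  (forall eps, 0 < eps -> step_scheme A W' v a b eps) ->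
  (forall eta, 0 < eta -> exists2 rho, 0 < rho &
    forall x y, a <= x <= b -> a <= y <= b -> `|x - y| <= rho ->
      `|u x - u y| <= eta /\ `|v x - v y| <= eta) ->
  (forall x, a <= x <= b -> `|u x - u a| <= theta /\ `|v x - v a| <= theta) ->
  posnorm (u b - v b) <= posnorm (u a - v a) +
    (b - a) * ((posnorm (u a - v a + h *: (c - c')) - posnorm (u a - v a)) / h
               + 8 * theta / h) + W c a b + W' c' a b.
Proof.
move=> hA ab h0 th0 WP W'P Su Sv uc osc; apply/ler_addgt0Pr => e e0.
set Gam := (_ / h + _ / h); set g := `|Gam|.
have g0 : 0 <= g by exact: normr_ge0.
(* [15 * eta] exceeds all errors together: five [eta] in [B], at most four in passing from the last
   nodes to [b], and at most two from the forcings, the drift and the penalty at the last nodes. *)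
have [eta eta0 ->] : exists2 eta, 0 < eta & e = 15 * eta.
  by exists (e / 15); [rewrite divr_gt0|field].
have [rho0 rho00 ucr] := uc _ eta0.
pose rho := Num.min rho0 (eta / (g + 1)).
have rho_gt0 : 0 < rho by rewrite lt_min rho00 divr_gt0// ltr_wpDl.
have rho_le : rho <= rho0 by rewrite ge_min lexx.
have rho_g : g * rho <= eta.
  have : rho <= eta / (g + 1) by rewrite ge_min lexx orbT.
  rewrite ler_pdivlMr; last by rewrite ltr_wpDl.
  by move: rho_gt0; nra.
(* The factor 4 makes [P * (rho / 2) ^+ 2] equal to [theta + g * (b - a)], the value that
   [boundary_bound] needs off the diagonal. *)
pose P := 4 * (theta + g * (b - a)) / rho ^+ 2.
have P_rho : P * rho ^+ 2 = 4 * (theta + g * (b - a)).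
  by rewrite /P divfK// expf_neq0// gt_eqF.
have ba0 : 0 < b - a by rewrite subr_gt0.
have [ba_ge0 th_ge0] := (ltW ba0, ltW th0).
have P0 : 0 <= P.
  by rewrite /P divr_ge0 ?sqr_ge0// mulr_ge0// addr_ge0// mulr_ge0.
clearbody P.
(* [Q] dominates, up to a factor of two, the total coefficient of [eps] in the errors of the barrier
   at the last nodes. *)
pose Q := g + 2 * P * (b - a) + P + 1.
have Q0 : 0 < Q.
  by rewrite ltr_wpDl// !addr_ge0// !mulr_ge0.
pose eps := Num.min (Num.min theta eta) (Num.min (rho / 2) (Num.min 1 (eta / Q))).
have eps0 : 0 < eps by rewrite !lt_min th0 eta0 ltr01 !divr_gt0.
have eps_ge0 := ltW eps0.
have eps_th : eps <= theta by rewrite !ge_min lexx ?orbT.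
have eps_eta : eps <= eta by rewrite !ge_min lexx ?orbT.
have eps_rho : eps <= rho / 2 by rewrite !ge_min lexx ?orbT.
have eps_1 : eps <= 1 by rewrite !ge_min lexx ?orbT.
have eps_Q : eps * Q <= eta.
  by rewrite -ler_pdivlMr// !ge_min lexx ?orbT.
have [N [t [w [x [[/andP[at0 t0a] /andP[btN tNb] tst] Wt ut Ax]]]]] := Su _ eps0.
have [M [s [w' [y [[/andP[as0 s0a] /andP[bsM sMb] sst] Ws vs Ay]]]]] := Sv _ eps0.
have tle k : (k < N)%N -> t k <= t k.+1.
  by move=> /tst/andP[/ltW]; rewrite subr_ge0.
have sle k : (k < M)%N -> s k <= s k.+1.
  by move=> /sst/andP[/ltW]; rewrite subr_ge0.
have tab k : (k <= N)%N -> a <= t k <= b.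
  move=> kN; rewrite (le_trans at0) ?(nodes_mono tle)//=.
  by rewrite (le_trans _ tNb)// (nodes_mono tle).
have sab k : (k <= M)%N -> a <= s k <= b.
  move=> kN; rewrite (le_trans as0) ?(nodes_mono sle)//=.
  by rewrite (le_trans _ sMb)// (nodes_mono sle).
have rN := step_scheme_forcing c WP at0 tNb tle Wt.
have rM := step_scheme_forcing c' W'P as0 sMb sle Ws.
(* The difference quotients of [r] and [r'] are the distances of the forcing values from [c] and
   [c'], the directional error left by [bracket_le]. *)
pose r k := \sum_(j < k) (t j.+1 - t j) * `|w j.+1 - c|.
pose r' l := \sum_(j < l) (s j.+1 - s j) * `|w' j.+1 - c'|.
have r0 k : (k <= N)%N -> 0 <= r k.
  move=> kN; apply: sumr_ge0 => j _; rewrite mulr_ge0// subr_ge0 tle//.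
  exact: leq_trans kN.
have r'0 k : (k <= M)%N -> 0 <= r' k.
  move=> kN; apply: sumr_ge0 => j _; rewrite mulr_ge0// subr_ge0 sle//.
  exact: leq_trans kN.
pose G := Gam + 2 * P * eps.
(* The penalty [P * (t k - s l) ^+ 2] dominates the boundary values off the
   diagonal and costs only [O(eps)] in the difference inequality, which the
   term [2 * P * eps] of [G] absorbs. *)
pose B k l := posnorm (u a - v a) + 5 * eta + G * (t k - t 0%N) + r k + r' l
              + P * (t k - s l) ^+ 2.
have aab : a <= a <= b by rewrite lexx ltW.
have Gk k : (k <= N)%N -> Gam * (t k - t 0%N) <= G * (t k - t 0%N).
  move=> kN; rewrite ler_wpM2r ?subr_ge0 ?(nodes_mono tle)// lerDl.
  by rewrite !mulr_ge0.
have Gabs k : (k <= N)%N -> - (g * (t k - t 0%N)) <= Gam * (t k - t 0%N).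
  move=> kN; rewrite -mulNr ler_wpM2r ?subr_ge0 ?(nodes_mono tle)//.
  by rewrite lerNl /g -normrN ler_norm.
(* [boundary_bound] uses three of the five [eta] in [B]; the other two cover the distances, at most
   [eps], of [x k] and [y l] from the solutions at the nodes. *)
have init k l : (k <= N)%N -> (l <= M)%N -> (k == 0%N) || (l == 0%N) ->
    posnorm (x k - y l) <= B k l.
  move=> kN lM kl0; have /andP[atk tkb] := tab _ kN; have /andP[asl slb] := sab _ lM.
  have ta : `|t k - a| = t k - a by rewrite ger0_norm ?subr_ge0.
  have sa : `|s l - a| = s l - a by rewrite ger0_norm ?subr_ge0.
  have t0k : t 0%N <= t k by exact: nodes_mono tle _ _ _ kN.
  have ukl : `|u (t k) - u a| + `|v (s l) - v a| + g * (t k - t 0%N) <=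
      3 * eta + P * (t k - s l) ^+ 2.
    apply: (boundary_bound (a := a) (b := b) (rho := rho) (eps := eps)
      (theta := theta)) => //.
    + by case/orP: kl0 => /eqP ->; [left|right]; rewrite lerBlDl.
    + by move=> ta_rho; have [|] := ucr (t k) a (tab _ kN) aab;
        rewrite // ta (le_trans ta_rho).
    + by move=> sa_rho; have [|] := ucr (s l) a (sab _ lM) aab;
        rewrite // sa (le_trans sa_rho).
    + by case: (osc _ (tab _ kN)).
    + by case: (osc _ (sab _ lM)).
  have := posnormB_le (x k) (y l) (u a) (v a).
  have : `|x k - u a| <= eps + `|u (t k) - u a|.
    apply: le_trans (ler_distD (u (t k)) _ _) _; rewrite lerD2r distrC.
    exact: ut.
  have : `|y l - v a| <= eps + `|v (s l) - v a|.
    apply: le_trans (ler_distD (v (s l)) _ _) _; rewrite lerD2r distrC.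
    exact: vs.
  have := Gk _ kN; have := Gabs _ kN; have := r0 _ kN; have := r'0 _ lM.
  by rewrite /B; clear -ukl eps_eta; lra.
have main k l : (k <= N)%N -> (l <= M)%N -> posnorm (x k - y l) <= B k l.
  apply: (discrete_comparison (d := fun k => t k.+1 - t k)
    (d' := fun l => s l.+1 - s l) (a := fun k l => posnorm (x k - y l))).
  - by move=> {}k /tst/andP[].
  - by move=> {}l /sst/andP[].
  - move=> {}k {}l kN lM /=.
    have /andP[d0 d_eps] := tst _ kN; have /andP[d'0 d'_eps] := sst _ lM.
    apply: le_trans (T_accretive_step hA d0 d'0 h0 (Ax _ kN) (Ay _ lM)) _.
    (* Each solution contributes the scheme error [eps <= theta] and the oscillation [theta];
       [bracket_le] turns [4 * theta] into [8 * theta / h]. *)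
    have pq : `|x k.+1 - y l.+1 - (u a - v a)| <= 4 * theta.
      have -> : x k.+1 - y l.+1 - (u a - v a) =
          (x k.+1 - u a) - (y l.+1 - v a).
        by rewrite !opprB [v a - u a]addrC addrACA [- y _ + _]addrC.
      apply: le_trans (ler_normB _ _) _.
      have := ler_distD (u (t k.+1)) (x k.+1) (u a).
      have := ler_distD (v (s l.+1)) (y l.+1) (v a).
      rewrite [`|x _ - u (t _)|]distrC [`|y _ - v (s _)|]distrC.
      have := ut _ kN; have := vs _ lM.
      have [+ _] := osc _ (tab _ kN); have [_ +] := osc _ (sab _ lM); lra.
    have zz : `|w k.+1 - w' l.+1 - (c - c')| <= `|w k.+1 - c| + `|w' l.+1 - c'|.
      have -> : w k.+1 - w' l.+1 - (c - c') = (w k.+1 - c) - (w' l.+1 - c').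
        by rewrite !opprB [c' - c]addrC addrACA [- w' _ + _]addrC.
      exact: ler_normB.
    apply: le_trans (bracket_le h0 pq zz) _.
    rewrite (_ : _ / h + _ = Gam); last by rewrite /Gam; lra.
    rewrite /B /r /r' !big_ord_recr/= -/(r k) -/(r' l).
    move: (t k.+1) (t k) (s l.+1) (s l) d0 d_eps d'0 d'_eps => tk1 tk sl1 sl.
    set e1 := `|_|; set e2 := `|_|; move=> d0 d_eps d'0 d'_eps.
    rewrite supersolution_quotients ?lt0r_neq0//.
    have : P * ((tk1 - tk) + (sl1 - sl)) <= P * (2 * eps).
      by rewrite ler_wpM2l//; lra.
    rewrite /G; lra.
  - by move=> {}k kN; apply: init; rewrite ?eqxx ?orbT.
  - by move=> {}l lM; apply: init; rewrite ?eqxx.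
have := main _ _ (leqnn N) (leqnn M).
have bab : a <= b <= b by rewrite lexx ltW.
have tNb' : `|b - t N| <= rho0 by rewrite ger0_norm ?subr_ge0//; lra.
have sMb' : `|b - s M| <= rho0 by rewrite ger0_norm ?subr_ge0//; lra.
have [ub _] := ucr _ _ bab (tab _ (leqnn N)) tNb'.
have [_ vb] := ucr _ _ bab (sab _ (leqnn M)) sMb'.
have := posnormB_le (u b) (v b) (x N) (y M).
have : `|u b - x N| <= eta + eps.
  apply: le_trans (ler_distD (u (t N)) _ _) _.
  by apply: lerD => //; exact: ut.
have : `|v b - y M| <= eta + eps.
  apply: le_trans (ler_distD (v (s M)) _ _) _.
  by apply: lerD => //; exact: vs.
rewrite /B.
(* Both last nodes lie within [eps] to the left of [b], and [eps <= 1] bounds the square by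
   [eps]. *)
have : P * (t N - s M) ^+ 2 <= P * eps.
  rewrite ler_wpM2l//; nra.
have : G * (t N - t 0%N) <= Gam * (b - a) + 2 * eps * g + 2 * P * eps * (b - a).
  have t_ba : t N - t 0%N <= b - a by lra.
  have : 2 * P * eps * (t N - t 0%N) <= 2 * P * eps * (b - a).
    by rewrite ler_wpM2l// !mulr_ge0.
  have : `|Gam * (b - a - (t N - t 0%N))| <= g * (2 * eps).
    by rewrite normrM -/g ler_wpM2l// ler_norml; lra.
  rewrite ler_norml => /andP[+ _]; rewrite /G; lra.
have Pe : 0 <= P * eps by rewrite mulr_ge0.
have Pe' : 0 <= P * eps * (b - a) by rewrite mulr_ge0.
have ge : 0 <= g * eps by rewrite mulr_ge0.
move: eps_Q; rewrite /Q; rewrite -/(r N) in rN; rewrite -/(r' M) in rM.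
move: rN rM ; rewrite [(b - a) * _]mulrC. 
set A1 := Gam * _. set A2 := G * _.
set A4 := (_ ^+ 2).
lra.
Qed.

End local_estimate.

(** * Summation over partitions: from short intervals to arbitrary ones *)

Section bracket_inequality.
Context {R : realType} {X : banachLatticeType R}.

(** The nodes are clamped to [[a, b]]. Each clamped piece either lies in one step of the partition
    or is degenerate, and additivity forces [Phi x x = 0]. *)
Lemma additive_le_sum (Phi : R -> R -> R) (t0 t1 : R) (N : nat)
    (t e : nat -> R) (a b : R) :
  (forall x y z, t0 <= x -> x <= y -> y <= z -> z <= t1 ->
    Phi x z = Phi x y + Phi y z) ->
  t 0%N = t0 -> t N = t1 -> (forall k, (k < N)%N -> t k <= t k.+1) ->
  (forall k, (k < N)%N -> 0 <= e k) ->
  (forall k x y, (k < N)%N -> t k <= x -> x <= y -> y <= t k.+1 ->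
    Phi x y <= e k) ->
  t0 <= a -> a <= b -> b <= t1 -> Phi a b <= \sum_(k < N) e k.
Proof.
move=> PhiD t00 tN1 tle e0 Phie at0 ab bt1.
have Phixx x : t0 <= x -> x <= t1 -> Phi x x = 0.
  by move=> h1 h2; have := PhiD x x x h1 (lexx _) (lexx _) h2; lra.
pose cl k := Num.max a (Num.min b (t k)).
have acl k : a <= cl k by rewrite le_max lexx.
have clb k : cl k <= b by rewrite ge_max ab ge_min lexx.
have H : forall n, (n <= N)%N -> Phi a (cl n) <= \sum_(k < n) e k.
  elim=> [|n IHn] nN.
    rewrite big_ord0 /cl t00 (min_idPr (le_trans at0 ab)) (max_idPl at0).
    by rewrite Phixx// (le_trans ab).
  have cle : cl n <= cl n.+1.
    rewrite /cl ge_max le_max lexx/= le_max le_min !ge_min lexx/= orbC.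
    by rewrite (tle _ nN) orbT.
  rewrite big_ord_recr/= (PhiD _ (cl n)) ?cle ?(le_trans (clb n.+1))//.
  rewrite lerD ?IHn//; first exact: ltnW.
  have [tna|atn] := lerP (t n.+1) a.
    have tnb := le_trans tna ab; have tn := tle _ nN.
    rewrite /cl (min_idPr tnb) (max_idPl tna).
    rewrite (min_idPr (le_trans tn tnb)) (max_idPl (le_trans tn tna)).
    by rewrite Phixx ?e0// (le_trans ab).
  have [btn|tnb] := lerP b (t n).
    have tn := tle _ nN.
    rewrite /cl (min_idPl btn) (min_idPl (le_trans btn tn)) (max_idPr ab).
    by rewrite Phixx ?e0// (le_trans at0).
  apply: Phie => //; first by rewrite /cl le_max le_min lexx (ltW tnb) orbT.
  by rewrite /cl ge_max (ltW atn) ge_min lexx orbT.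
have := H _ (leqnn N); rewrite /cl tN1 (min_idPl bt1) (max_idPr ab).
exact.
Qed.

Lemma L1_deviation_sub (W : X -> R -> R -> R) (t0 t1 a b : R) :
  L1_deviation W t0 t1 -> t0 <= a -> b <= t1 -> L1_deviation W a b.
Proof.
move=> [W0 WD Wt] ta bt; split=> [c x y ax xy yb|c x y z ax xy yz zb|].
- by apply: W0 => //; [exact: le_trans ax|exact: le_trans bt].
- by apply: WD => //; [exact: le_trans ax|exact: le_trans bt].
- by move=> c c' x y ax xy yb; apply: Wt => //;
    [exact: le_trans ax|exact: le_trans bt].
Qed.

(** The form that [eps_approximable] yields. It does not restrict to subintervals, whose endpoints
    need not be nodes; hence the weaker [step_scheme]. *)
Definition full_scheme (A : X -> set X) (W : X -> R -> R -> R) (u : R -> X)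
    (t0 t1 eps : R) : Prop :=
  exists (N : nat) (t : nat -> R) (w v : nat -> X),
  [/\ [/\ t 0%N = t0, t N = t1 &
        forall k, (k < N)%N -> 0 < t k.+1 - t k <= eps],
      \sum_(k < N) W (w k.+1) (t k) (t k.+1) <= eps,
      forall k, (k <= N)%N -> `|u (t k) - v k| <= eps &
      forall k, (k < N)%N ->
        A (v k.+1) (w k.+1 - (t k.+1 - t k)^-1 *: (v k.+1 - v k))].

(** The nodes kept run from the first one at or after [a] to the last one at or before [b]. The mesh
    bound puts these within [eps] of the endpoints, and [2 * eps < b - a] keeps them in order; the
    dropped terms of the forcing sum are nonnegative. *)
Lemma full_scheme_sub (A : X -> set X) (W : X -> R -> R -> R) (u : R -> X)
    (t0 t1 a b eps : R) :
  L1_deviation W t0 t1 -> t0 <= a -> b <= t1 -> 0 < eps -> 2 * eps < b - a ->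
  full_scheme A W u t0 t1 eps -> step_scheme A W u a b eps.
Proof.
move=> [W0 _ _] t0a bt1 eps0 eps_ba [N [t [w [v [[tt0 tt1 tst] Ws uv Av]]]]].
have tle k : (k < N)%N -> t k <= t k.+1.
  by move=> /tst/andP[/ltW]; rewrite subr_ge0.
have tm := nodes_mono tle.
have exk0 : exists k, a <= t k by exists N; rewrite tt1; lra.
have exk1 : exists k, (k <= N)%N && (t k <= b) by exists 0%N; rewrite leq0n tt0 /=; lra.
have bdk1 k : (k <= N)%N && (t k <= b) -> (k <= N)%N by move=> /andP[].
case: (ex_minnP exk0) => k0 ak0 k0min.
case: (ex_maxnP exk1 bdk1) => k1 /andP[k1N k1b] k1max.
have k0N : (k0 <= N)%N by apply: k0min; rewrite tt1; lra.
have tk0 : t k0 <= a + eps.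
  case: k0 ak0 k0min k0N => [|k] ak kmin kN; first by rewrite tt0; lra.
  have tka : t k < a by rewrite ltNge; apply/negP => /kmin; rewrite ltnn.
  have /andP[_] := tst _ kN; lra.
have tk1 : b - eps <= t k1.
  move: k1N; rewrite leq_eqVlt => /predU1P[->|k1N]; first by rewrite tt1; lra.
  have : b < t k1.+1.
    rewrite ltNge; apply/negP => h; have := k1max k1.+1.
    by rewrite k1N h => /(_ isT); rewrite ltnn.
  have /andP[_] := tst _ k1N; lra.
have k01 : (k0 <= k1)%N by apply: k0min; lra.
exists (k1 - k0)%N, (fun k => t (k0 + k)%N), (fun k => w (k0 + k)%N),
  (fun k => v (k0 + k)%N); split.
- rewrite addn0 subnKC// ak0 tk0 tk1 k1b; split=> // k kk; rewrite addnS tst//.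
  by apply: leq_trans k1N; rewrite -ltn_subRL.
- apply: le_trans Ws.
  rewrite -(big_mkord xpredT (fun k => W (w k.+1) (t k) (t k.+1))).
  rewrite (@big_cat_nat _ _ _ k0)//= (@big_cat_nat _ _ _ k1 k0)//=.
  have WN k : (k < N)%N -> 0 <= W (w k.+1) (t k) (t k.+1).
    move=> kN; apply: W0; first by rewrite -tt0; apply: tm => //; exact: ltnW.
      exact: tle.
    by rewrite -tt1; exact: tm.
  have -> : \sum_(k < k1 - k0) W (w (k0 + k.+1)%N) (t (k0 + k)%N) (t (k0 + k.+1)%N)
      = \sum_(k0 <= i < k1) W (w i.+1) (t i) (t i.+1).
    rewrite -[k0 in RHS]add0n big_addn big_mkord.
    by apply: eq_bigr => k _; rewrite addnS addnC.
  have h1 : 0 <= \sum_(0 <= i < k0) W (w i.+1) (t i) (t i.+1).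
    rewrite big_nat sumr_ge0// => i /andP[_ ik0].
    by apply: WN; exact: leq_trans k0N.
  have h2 : 0 <= \sum_(k1 <= i < N) W (w i.+1) (t i) (t i.+1).
    by rewrite big_nat sumr_ge0// => i /andP[_ ik0]; exact: WN.
  lra.
- move=> k kk; apply: uv; apply: leq_trans k1N.
  by rewrite -(subnKC k01) leq_add2l.
- move=> k kk; rewrite addnS; apply: Av; apply: leq_trans k1N.
  by rewrite -ltn_subRL.
Qed.

Lemma step_scheme_le (A : X -> set X) (W : X -> R -> R -> R) (u : R -> X)
    (a b eps eps' : R) : eps <= eps' ->
  step_scheme A W u a b eps -> step_scheme A W u a b eps'.
Proof.
move=> ee [N [t [w [v [[/andP[at0 t0a] /andP[btN tNb] tst] Ws uv Av]]]]].
exists N, t, w, v; split=> //.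
- rewrite at0 tNb (le_trans t0a) ?lerD2l// andbT (le_trans _ btN) ?lerB//.
  by split=> // k /tst/andP[-> /le_trans ->].
- exact: le_trans Ws ee.
- by move=> k /uv/le_trans ->.
Qed.

Lemma le_of_eps (x y C : R) : (forall e, 0 < e -> x <= y + C * e) -> x <= y.
Proof.
move=> h; apply/ler_addgt0Pr => e e0.
have C0 : 0 < `|C| + 1 by rewrite ltr_wpDl.
apply: le_trans (h (e / (`|C| + 1)) _) _; first exact: divr_gt0.
rewrite lerD2l mulrA ler_pdivrMr// mulrC ler_pM2l//.
by apply: le_trans (ler_norm C) _; rewrite lerDl.
Qed.

(** This eliminates a frozen constant: on each step of a fine scheme [c] is taken to be the value
    [w k.+1], and the deviations then sum to at most [e]. *)
Lemma additive_le0 (A : X -> set X) (V : X -> R -> R -> R) (u : R -> X)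
    (t0 t1 rho : R) (Psi : R -> R -> R) :
  L1_deviation V t0 t1 -> 0 < rho ->
  (forall eps, 0 < eps -> full_scheme A V u t0 t1 eps) ->
  (forall x y z, t0 <= x -> x <= y -> y <= z -> z <= t1 ->
    Psi x z = Psi x y + Psi y z) ->
  (forall c x y, t0 <= x -> x <= y -> y <= t1 -> y - x <= rho ->
    Psi x y <= 2 * V c x y) ->
  forall a b, t0 <= a -> a <= b -> b <= t1 -> Psi a b <= 0.
Proof.
move=> [V0 VD _] rho0 Su PsiD Psi_V a b t0a ab bt1.
apply: (@le_of_eps _ _ 2) => e e0; rewrite add0r.
have e'0 : 0 < Num.min e rho by rewrite lt_min e0.
have [N [s [w [_ [[s0 sN sst] Ws _ _]]]]] := Su _ e'0.
have sle k : (k < N)%N -> s k <= s k.+1.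
  by move=> /sst/andP[/ltW]; rewrite subr_ge0.
have sm := nodes_mono sle.
have t0s k : (k <= N)%N -> t0 <= s k by move=> kN; rewrite -s0; exact: sm.
have st1 k : (k <= N)%N -> s k <= t1 by move=> kN; rewrite -sN; exact: sm.
have Ws_e : \sum_(k < N) V (w k.+1) (s k) (s k.+1) <= e.
  by apply: le_trans Ws _; rewrite ge_min lexx.
apply: le_trans (_ : _ <= 2 * \sum_(k < N) V (w k.+1) (s k) (s k.+1)) _; last first.
  by rewrite ler_pM2l.
rewrite mulr_sumr.
apply: (additive_le_sum (e := fun k => 2 * V (w k.+1) (s k) (s k.+1)) PsiD s0 sN)
  => // [k kN|k p q kN sp pq qs].
  by rewrite mulr_ge0// V0 ?t0s ?st1 ?sle//; exact: ltnW.
have t0p : t0 <= p by apply: le_trans sp; apply: t0s; exact: ltnW.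
have qt1 : q <= t1 by apply: le_trans qs _; exact: st1.
apply: le_trans (Psi_V (w k.+1) _ _ t0p pq qt1 _) _.
  have /andP[_] := sst _ kN.
  have : Num.min e rho <= rho by rewrite ge_min lexx orbT.
  by move: sp qs; clear; lra.
have skn : t0 <= s k by apply: t0s; exact: ltnW.
have sk1 : s k.+1 <= t1 by exact: st1.
rewrite ler_pM2l// (VD _ (s k) p (s k.+1)) ?(le_trans pq)//.
rewrite (VD _ p q (s k.+1))// addrCA lerDl addr_ge0// V0//.
  exact: le_trans qt1.
exact: le_trans pq.
Qed.

(** The partitions belonging to [u] and [v] are unrelated, so the constants are eliminated in turn:
    first [c'] along the schemes of [v] with [c] fixed, then [c] along those of [u]. [Gint] stands
    for the integral of the bracket. *)
Lemma bracket_inequality (A : X -> set X) (W W' : X -> R -> R -> R)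
    (u v : R -> X) (t0 t1 h : R) (Gint : R -> R -> R) :
  T_accretive A -> 0 < h ->
  L1_deviation W t0 t1 -> L1_deviation W' t0 t1 ->
  (forall eps, 0 < eps -> full_scheme A W u t0 t1 eps) ->
  (forall eps, 0 < eps -> full_scheme A W' v t0 t1 eps) ->
  (forall eta, 0 < eta -> exists2 rho, 0 < rho &
    forall x y, t0 <= x <= t1 -> t0 <= y <= t1 -> `|x - y| <= rho ->
      `|u x - u y| <= eta /\ `|v x - v y| <= eta) ->
  (forall x y z, t0 <= x -> x <= y -> y <= z -> z <= t1 ->
    Gint x z = Gint x y + Gint y z) ->
  (forall a b c c' theta, t0 <= a -> a <= b -> b <= t1 ->
    (forall x, a <= x <= b -> `|u x - u a| <= theta /\ `|v x - v a| <= theta) ->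
    (b - a) * ((posnorm (u a - v a + h *: (c - c')) - posnorm (u a - v a)) / h)
      <= Gint a b + 4 * theta / h * (b - a) + W c a b + W' c' a b) ->
  forall a b, t0 <= a -> a <= b -> b <= t1 ->
    posnorm (u b - v b) <= posnorm (u a - v a) + Gint a b.
Proof.
move=> hA h0 WP W'P Su Sv uc GD Glb a b t0a ab bt1.
apply: (@le_of_eps _ _ (b - a)) => kap kap0.
(* With 12, the errors [8 * th / h] of [local_estimate] and [4 * th / h] of [Glb] add up to
   [kap]. *)
have th0 : 0 < kap * h / 12 by rewrite divr_gt0// mulr_gt0.
set th := kap * h / 12 in th0.
have [rho rho0 uc_rho] := uc _ th0.
have [W0 WD Wt] := WP; have [W'0 W'D W't] := W'P.
(* Each deviation appears twice, once from [local_estimate] and once from [Glb]. *)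
have local c c' x y : t0 <= x -> x <= y -> y <= t1 -> y - x <= rho ->
    posnorm (u y - v y) <= posnorm (u x - v x) + Gint x y + kap * (y - x)
      + 2 * W c x y + 2 * W' c' x y.
  move=> t0x; rewrite le_eqVlt => /predU1P[<-|xy] yt1 xy_rho.
    have := GD x x x t0x (lexx _) (lexx _) yt1.
    have := W0 c x x t0x (lexx _) yt1; have := W'0 c' x x t0x (lexx _) yt1.
    by clear; lra.
  have osc z : x <= z <= y -> `|u z - u x| <= th /\ `|v z - v x| <= th.
    move=> /andP[xz zy]; apply: uc_rho.
    - by rewrite (le_trans t0x xz) (le_trans zy yt1).
    - by rewrite t0x (le_trans (ltW xy) yt1).
    - by rewrite ger0_norm ?subr_ge0// (le_trans _ xy_rho)// lerD2r.
  have schemes V z : L1_deviation V t0 t1 ->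
      (forall eps, 0 < eps -> full_scheme A V z t0 t1 eps) ->
      forall eps, 0 < eps -> step_scheme A V z x y eps.
    move=> VP Sz eps eps0; pose e' := Num.min eps ((y - x) / 3).
    have yx0 : 0 < y - x by rewrite subr_gt0.
    apply: (@step_scheme_le _ _ _ _ _ e'); first by rewrite ge_min lexx.
    have e'0 : 0 < e' by rewrite lt_min eps0 divr_gt0.
    apply: full_scheme_sub VP t0x yt1 e'0 _ (Sz _ e'0).
    have : e' <= (y - x) / 3 by rewrite ge_min lexx orbT.
    by move: yx0; clear; lra.
  have := local_estimate c c' hA xy h0 th0 (L1_deviation_sub WP t0x yt1)
    (L1_deviation_sub W'P t0x yt1) (schemes _ _ WP Su) (schemes _ _ W'P Sv) _ osc.
  have {}uc' : forall eta, 0 < eta -> exists2 rho, 0 < rho &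
    forall z z', x <= z <= y -> x <= z' <= y -> `|z - z'| <= rho ->
      `|u z - u z'| <= eta /\ `|v z - v z'| <= eta.
    move=> eta /uc[r r0 ur]; exists r => // z z' /andP[xz zy] /andP[xz' zy'].
    by apply: ur; rewrite ?(le_trans t0x)//= (le_trans _ yt1).
  move=> /(_ uc'); have := Glb _ _ c c' th t0x (ltW xy) yt1 osc.
  rewrite [(y - x) * (_ + 8 * th / h)]mulrDr.
  have -> : (y - x) * (8 * th / h) = kap * (8 / 12) * (y - x).
    by rewrite /th; field; rewrite gt_eqF.
  have -> : 4 * th / h * (y - x) = kap * (4 / 12) * (y - x).
    by rewrite /th; field; rewrite gt_eqF.
  by clear; lra.
have layer c x y : t0 <= x -> x <= y -> y <= t1 ->
    posnorm (u y - v y) - posnorm (u x - v x) - Gint x y - kap * (y - x)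
      - 2 * W c x y <= 0.
  apply: (additive_le0 (Psi := fun x y => posnorm (u y - v y)
    - posnorm (u x - v x) - Gint x y - kap * (y - x) - 2 * W c x y) W'P rho0 Sv).
    move=> p q r tp pq qr rt; rewrite (GD _ _ _ tp pq qr rt).
    by rewrite (WD c _ _ _ tp pq qr rt); clear; lra.
  move=> c' p q tp pq qt pq_rho; have := local c c' p q tp pq qt pq_rho.
  by clear; lra.
(* [layer] holds on intervals of every length, so [rho] can be [1] here. *)
have := additive_le0 (Psi := fun x y => posnorm (u y - v y)
  - posnorm (u x - v x) - Gint x y - kap * (y - x)) WP ltr01 Su _ _ t0a ab bt1.
move=> H; suff : posnorm (u b - v b) - posnorm (u a - v a) - Gint a b
    - kap * (b - a) <= 0 by clear; lra.
apply: H => [p q r tp pq qr rt|c p q tp pq qt _].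
  by rewrite (GD _ _ _ tp pq qr rt); clear; lra.
by have := layer c p q tp pq qt; clear; lra.
Qed.

End bracket_inequality.

(** * Measurability and integration *)

Section strong_measurability.
Context {R : realType} {X : completeNormedModType R}.
Local Notation mu := (@lebesgue_measure R).

(** Convergence is required everywhere on [D], because an almost everywhere limit of Borel functions
    need not be Borel. *)
Definition strongly_measurable (D : set R) (w : R -> X) : Prop :=
  exists s : nat -> R -> X, (forall n, simple_function (s n)) /\
    forall t, D t -> s n t @[n --> \oo] --> w t.

(** [s] has finitely many values, and on each level set the composite is some [F ^~ c]. *)
Lemma measurable_fun_simple_comp (D : set R) (F : R -> X -> R) (s : R -> X) :
  (forall c, measurable_fun D (F ^~ c)) -> simple_function s ->
  measurable_fun D (fun t => F t (s t)).
Proof.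
move=> mF [fs ms] mD Y mY.
rewrite (_ : D `&` _ = \bigcup_(c in range s)
    (s @^-1` [set c] `&` (D `&` (F ^~ c) @^-1` Y))); last first.
  apply/seteqP; split => [t [Dt Yt]|t [c _ [<- [Dt Yt]]]]; last by split.
  by exists (s t); [exists t|].
apply: fin_bigcup_measurable => // c _.
by apply: measurableI; [exact: ms|exact: mF].
Qed.

(** Superposition with a Caratheodory function: continuity in the state passes measurability from
    simple functions to their limit. *)
Lemma measurable_fun_strong_comp (D : set R) (F : R -> X -> R) (w : R -> X) :
  (forall c, measurable_fun D (F ^~ c)) -> (forall t, D t -> continuous (F t)) ->
  strongly_measurable D w -> measurable_fun D (fun t => F t (w t)).
Proof.
move=> mF cF [s [ss sw]].
apply: (@measurable_fun_cvg _ _ _ D (fun n t => F t (s n t))).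
  by move=> n; exact: measurable_fun_simple_comp.
by move=> t Dt; apply: (cvg_comp _ _ (sw t Dt)); exact: cF.
Qed.

(** A Borel null set [N] contains the exceptional set; putting both the function and its
    approximants equal to [0] on [N] gives convergence everywhere. *)
Lemma ae_strongly_measurable_version (D : set R) (w : R -> X) :
  ae_strongly_measurable D w -> exists N, [/\ measurable N, mu N = 0 &
    strongly_measurable D (fun t => if t \in N then 0 else w t)].
Proof.
move=> [s [ss [N [mN N0 Nsub]]]]; exists N; split=> //.
exists (fun n t => if t \in N then 0 else s n t); split=> [n|t Dt]; last first.
  have [tN|tN] := boolP (t \in N); first exact: cvg_cst.
  apply: contrapT => h; move/negP: tN; apply; rewrite inE; apply: Nsub => /=.
  by move=> h'; apply: h; exact: h'.
have [fs ms] := ss n; split=> [|x].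
  apply: (@sub_finite_set _ _ (range (s n) `|` [set 0])).
    by move=> _ [t _ <-]; case: ifPn => _; [right|left; exists t].
  by rewrite finite_setU; split.
rewrite (_ : _ @^-1` _ = (~` N `&` s n @^-1` [set x]) `|`
    (if x == 0 then N else set0)).
  apply: measurableU; last by case: ifP.
  by apply: measurableI; [exact: measurableC|exact: ms].
apply/seteqP; split=> t /=.
  have [/set_mem tN <-|/negP tN <-] := boolP (t \in N).
    by right; rewrite eqxx.
  by left; split=> // /mem_set.
case=> [[tN <-]|]; first by rewrite memNset.
by case: eqP => // -> /mem_set ->.
Qed.

(* [g] need not be measurable: the integral of a nonnegative function is a
   supremum over its simple minorants. *)
Lemma integral_le_of_ae (D N : set R) (f g : R -> \bar R) :
  measurable D -> measurable N -> mu N = 0 -> measurable_fun D f ->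
  (forall t, D t -> (0 <= f t)%E) -> (forall t, D t -> (0 <= g t)%E) ->
  (forall t, D t -> ~ N t -> (f t <= g t)%E) ->
  (\int[mu]_(t in D) f t <= \int[mu]_(t in D) g t)%E.
Proof.
move=> mD mN N0 mf f0 g0 fg.
(* Once [N] is removed from the domain of [f], every simple minorant of [f], extended by [0], is
   also one of [g]. *)
have -> : (\int[mu]_(t in D) f t = \int[mu]_(t in D `\` N) f t)%E.
  exact: ge0_negligible_integral.
rewrite integral_mkcond [leRHS]integral_mkcond.
rewrite ge0_integralTE; last first.
  by move=> t; rewrite /patch; case: ifPn => // /set_mem[Dt _]; exact: f0.
rewrite ge0_integralTE; last first.
  by move=> t; rewrite /patch; case: ifPn => // /set_mem Dt; exact: g0.
apply: le_ereal_sup => _ [h /= hf <-]; exists h => //= t.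
apply: le_trans (hf t) _; rewrite /patch.
case: ifPn => [/set_mem[Dt Nt]|_]; first by rewrite mem_set//; exact: fg.
by case: ifPn => // /set_mem; exact: g0.
Qed.

Lemma strongly_measurable_dist (D : set R) (w : R -> X) (c : X) :
  strongly_measurable D w -> measurable_fun D (fun t => `|w t - c|).
Proof.
apply: (@measurable_fun_strong_comp _ (fun _ x => `|x - c|)) => // t _ x.
apply: (@continuous_comp _ _ _ (fun x => x - c)); last exact: norm_continuous.
by apply: cvgB; [exact: cvg_id|exact: cvg_cst].
Qed.

End strong_measurability.

(** * Uniform continuity and integrals on compact intervals *)

Section interval_tools.
Context {R : realType}.
Local Notation mu := (@lebesgue_measure R).

Lemma within_continuousP {V : normedModType R} (D : set R) (u : R -> V) :
  {within D, continuous u} <-> forall x, D x -> forall eta, 0 < eta ->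
    exists2 d, 0 < d & forall y, D y -> `|y - x| < d -> `|u y - u x| < eta.
Proof.
split=> [/subspace_continuousP cu x Dx eta eta0|cu].
  have /cvgrPdist_lt/(_ _ eta0) := cu x Dx.
  rewrite near_withinE => /nbhs_ballP[d d0 dP]; exists d => // y Dy yx.
  by rewrite distrC; apply: dP => //; rewrite -ball_normE /= distrC.
apply/subspace_continuousP => x Dx; apply/cvgrPdist_lt => eta eta0.
have [d d0 dP] := cu x Dx eta eta0; rewrite near_withinE.
apply/nbhs_ballP; exists d => // y; rewrite -ball_normE /= distrC => yx Dy.
by rewrite distrC; exact: dP.
Qed.

(** Heine-Cantor theorem; the near-covering form of compactness yields one [rho] for all [x]. *)
Lemma within_continuous_itv_unif {V : normedModType R} (a b : R) (u : R -> V) :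
  {within `[a, b], continuous u} -> forall eta, 0 < eta ->
  exists2 rho, 0 < rho & forall x y, a <= x <= b -> a <= y <= b ->
    `|x - y| <= rho -> `|u x - u y| <= eta.
Proof.
move=> /within_continuousP cu eta eta0.
have /compact_near_coveringP/near_covering_withinP cov := @segment_compact R a b.
have : \forall rho \near 0^'+, `[a, b] `<=` (fun x => forall y, a <= y <= b ->
    `|x - y| <= rho -> `|u x - u y| <= eta).
  apply: (cov _ _ (fun rho x => forall y, a <= y <= b ->
    `|x - y| <= rho -> `|u x - u y| <= eta)) => x abx.
  have [d d0 dP] := cu x abx (eta / 2) (divr_gt0 eta0 (ltr0n _ 2)).
  exists (ball x (d / 2), [set r | r < d / 2]).
    split=> /=; first by apply: nbhsx_ballx; rewrite divr_gt0.
    by apply: nbhs_right_lt; rewrite divr_gt0.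
  move=> [z r] /= [zx rd] abz y aby zy.
  move: zx; rewrite -ball_normE /= => zx.
  have uz : `|u z - u x| < eta / 2.
    by apply: dP => //; rewrite distrC; apply: lt_trans zx _; lra.
  have uy : `|u y - u x| < eta / 2.
    apply: dP; first by rewrite /= in_itv.
    have := ler_distD z y x; rewrite [`|y - z|]distrC [`|z - x|]distrC; lra.
  have := ler_distD (u x) (u z) (u y); rewrite [`|u x - u y|]distrC; lra.
move=> /(filterI (nbhs_right_gt (0 : R)))/filter_ex[rho [rho0 Hr]].
by exists rho => // x y abx aby; apply: Hr => //=; rewrite in_itv.
Qed.

Lemma integrableD_EFin (D : set R) (f g : R -> R) : measurable D ->
  mu.-integrable D (EFin \o f) -> mu.-integrable D (EFin \o g) ->
  mu.-integrable D (EFin \o (fun t => f t + g t)).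
Proof.
move=> mD mf mg.
have : mu.-integrable D ((EFin \o f) \+ (EFin \o g))%E by exact: integrableD.
exact.
Qed.

Lemma Rintegral_itv_cat (f : R -> R) (x y z : R) : x <= y -> y <= z ->
  mu.-integrable `[x, z] (EFin \o f) ->
  \int[mu]_(t in `[x, z]) f t =
  \int[mu]_(t in `[x, y]) f t + \int[mu]_(t in `[y, z]) f t.
Proof.
move=> xy yz intf; have := Rintegral_itvB intf.
move=> /(_ y); rewrite !bnd_simp => /(_ xy yz) H.
rewrite -(@Rintegral_itv_obnd_cbnd _ y) -?H; first by rewrite addrC subrK.
apply: integrableS intf => // t /=; rewrite !in_itv/= => /andP[yt ->].
by rewrite (le_trans xy)// ltW.
Qed.

Lemma Rintegral_itv_cst (a b r : R) : a <= b ->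
  \int[mu]_(t in `[a, b]) r = r * (b - a).
Proof.
move=> ab; have mu_ab : mu `[a, b] = (b - a)%:E.
  rewrite lebesgue_measure_itv/= lte_fin; case: ltP => //= ba.
  by congr (_%:E); apply/eqP; rewrite eq_sym subr_eq0 eq_le ba.
transitivity (r * fine (mu `[a, b])); last by rewrite mu_ab.
exact: (@Rintegral_cst _ _ _ mu).
Qed.

End interval_tools.

(** * Mild solutions *)

Section mild_bracket.
Context {R : realType} {X : banachLatticeType R}.
Local Notation mu := (@lebesgue_measure R).
Implicit Types (A : X -> set X) (u v w : R -> X) (a b x y : R) (c : X).

Definition deviation w c x y : R := \int[mu]_(t in `[x, y]) `|w t - c|.

Lemma integrable_itvS (f : R -> R) (t0 t1 a b : R) : t0 <= a -> b <= t1 ->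
  mu.-integrable `[t0, t1] (EFin \o f) -> mu.-integrable `[a, b] (EFin \o f).
Proof.
move=> t0a bt1; apply: integrableS => // t /=; rewrite !in_itv/= => /andP[at_ tb].
by rewrite (le_trans t0a)//= (le_trans tb).
Qed.

(** The third clause integrates the triangle inequality through [w t]. *)
Lemma deviation_L1 w (t0 t1 : R) :
  (forall c, mu.-integrable `[t0, t1] (EFin \o (fun t => `|w t - c|))) ->
  L1_deviation (deviation w) t0 t1.
Proof.
move=> iw; split=> [c x y _ _ _|c x y z t0x xy yz zt1|c c' x y t0x xy yt1].
- by apply: Rintegral_ge0 => t _.
- by apply: Rintegral_itv_cat => //; exact: integrable_itvS (iw c).
- rewrite mulrC -Rintegral_itv_cst// /deviation -RintegralD//; first last.
  + exact: integrable_itvS (iw c').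
  + exact: integrable_itvS (iw c).
  apply: le_Rintegral => //.
  + by apply: continuous_compact_integrable;
      [exact: segment_compact|exact: cst_continuous].
  + by apply: integrableD_EFin => //; exact: integrable_itvS (iw _).
  + move=> t _; rewrite [`|w t - c|]distrC; exact: ler_distD.
Qed.

(* The forcing [w] is replaced by a version [w'] for which the deviations
   [`|w' t - c|] are Borel measurable. *)
Definition forcing_version A (t0 t1 : R) w u w' : Prop :=
  [/\ strongly_measurable `[t0, t1] w',
      forall c, mu.-integrable `[t0, t1] (EFin \o (fun t => `|w' t - c|)),
      {ae mu, forall t, t \in `[t0, t1] -> w' t = w t} &
      forall eps, 0 < eps -> full_scheme A (deviation w') u t0 t1 eps].

(** [w] is set to [0] on a Borel null set. By [integral_le_of_ae] this does not increase the forcing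
    errors, so the approximating schemes of [w] serve for the new version. *)
Lemma forcing_version_exists A (t0 t1 : R) w u (z : X) :
  mild_solution A t0 t1 w z u -> exists w', forcing_version A t0 t1 w u w'.
Proof.
move=> [_ [sw iw] _ appr].
have [N [mN N0 sw']] := ae_strongly_measurable_version sw.
pose w' t := if t \in N then 0 else w t.
have w'E t : ~ N t -> w' t = w t by move=> Nt; rewrite /w' memNset.
have mw' c (D : set R) : D `<=` `[t0, t1] -> measurable_fun D (fun t => `|w' t - c|).
  by move=> D01; apply: measurable_funS (strongly_measurable_dist c sw') => //.
have norm_w' : (fun t => `|w' t - 0|) = (fun t => `|w' t|).
  by apply/funext => t; rewrite subr0.
have i0 : mu.-integrable `[t0, t1] (EFin \o (fun t => `|w' t|)).
  apply/integrableP; split.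
    by apply/measurable_EFinP; rewrite -norm_w'; exact: mw'.
  apply: le_lt_trans iw; apply: (integral_le_of_ae (N := N)) => //.
  - apply/measurable_EFinP; apply: measurableT_comp => //.
    by rewrite -norm_w'; exact: mw'.
  - by move=> t _ /w'E /= ->; rewrite normr_id.
have ic c : mu.-integrable `[t0, t1] (EFin \o (fun t => `|w' t - c|)).
  have icst : mu.-integrable `[t0, t1] (EFin \o (fun _ : R => `|c|)).
    by apply: continuous_compact_integrable;
      [exact: segment_compact|exact: cst_continuous].
  have := integrableD_EFin (measurable_itv _) i0 icst.
  apply: le_integrable => //; first by apply/measurable_EFinP; exact: mw'.
  move=> t _ /=; rewrite !lee_fin normr_id [leRHS]ger0_norm ?addr_ge0//.
  exact: ler_normB.
exists w'; split=> //.
  exists N; split=> // t /= ht; apply: contrapT => /w'E h; apply: ht => _.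
  exact: h.
move=> eps eps0; have [n [t [wk [v [[t_0 t_n tst] Wn v0 Av [u0 uv]]]]]] := appr _ eps0.
exists n, t, wk, v; split=> //.
- by split=> // k /tst[tk /ltW ->]; rewrite subr_gt0 tk.
- rewrite -lee_fin; apply: le_trans (ltW Wn); rewrite -sumEFin.
  have tle k : (k < n)%N -> t k <= t k.+1 by move=> /tst[/ltW].
  apply: lee_sum => k _.
  have t0k : t0 <= t k by rewrite -t_0 (nodes_mono tle)// ltnW.
  have kt1 : t k.+1 <= t1 by rewrite -t_n (nodes_mono tle).
  rewrite /deviation /Rintegral fineK; last first.
    by apply: integrable_fin_num => //; exact: integrable_itvS (ic _).
  apply: (integral_le_of_ae (N := N)) => //.
  + apply/measurable_EFinP; apply: mw' => y /=; rewrite !in_itv/= => /andP[ky yk].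
    by rewrite (le_trans t0k)//= (le_trans yk).
  by move=> y _ /w'E ->.
(* The initial node carries the starting value, and node [k.+1] belongs to the half-open step that
   it closes. *)
- by case=> [|k] kn; [rewrite t_0 v0|apply: uv => //; rewrite lexx andbT; case: (tst _ kn)].
Qed.

Definition bracket (h : R) (p q : X) : R := (posnorm (p + h *: q) - posnorm p) / h.

Lemma posnorm_dist_le (p q : X) : `|posnorm p - posnorm q| <= `|p - q|.
Proof.
rewrite ler_norml; have := posnorm_le_dist p q; have := posnorm_le_dist q p.
by rewrite [`|q - p|]distrC => *; apply/andP; split; lra.
Qed.

(** The bound is independent of [h] and provides the dominating function for the limit [h -> 0]. *)
Lemma norm_bracket_le (h : R) (p q : X) : 0 < h -> `|bracket h p q| <= `|q|.
Proof.
move=> h0; rewrite /bracket normrM normfV (gtr0_norm h0) ler_pdivrMr//.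
apply: le_trans (posnorm_dist_le _ _) _.
by rewrite addrC addKr normrZ (gtr0_norm h0) mulrC.
Qed.

Lemma within_continuous_posnorm (D : set R) u v c :
  {within D, continuous u} -> {within D, continuous v} ->
  {within D, continuous (fun t => posnorm (u t - v t + c))}.
Proof.
move=> /within_continuousP cu /within_continuousP cv.
apply/within_continuousP => x Dx eta eta0.
have [d d0 dP] := cu x Dx _ (divr_gt0 eta0 (ltr0n _ 2)).
have [e e0 eP] := cv x Dx _ (divr_gt0 eta0 (ltr0n _ 2)).
exists (Num.min d e); first by rewrite lt_min d0.
move=> y Dy; rewrite lt_min => /andP[yd ye].
apply: le_lt_trans (posnorm_dist_le _ _) _.
rewrite opprD addrACA subrr addr0.
have -> : u y - v y - (u x - v x) = u y - u x - (v y - v x).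
  by rewrite !opprB [v x - u x]addrC addrACA [- v y + _]addrC.
apply: le_lt_trans (ler_normB _ _) _.
have := dP _ Dy yd; have := eP _ Dy ye; lra.
Qed.

Lemma within_continuous_posnormB (D : set R) u v :
  {within D, continuous u} -> {within D, continuous v} ->
  {within D, continuous (fun t => posnorm (u t - v t))}.
Proof.
move=> cu cv; have := within_continuous_posnorm (c := 0) cu cv.
rewrite (_ : (fun t => posnorm (u t - v t + 0)) =
  (fun t => posnorm (u t - v t)))//.
by apply/funext => t; rewrite addr0.
Qed.

Lemma integrable_norm_of_dist (D : set R) w :
  (forall c, mu.-integrable D (EFin \o (fun t => `|w t - c|))) ->
  mu.-integrable D (EFin \o (fun t => `|w t|)).
Proof.
move=> /(_ 0); rewrite (_ : (fun t => `|w t - 0|) = (fun t => `|w t|))//.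
by apply/funext => t; rewrite subr0.
Qed.

Lemma integrable_bracket (t0 t1 h : R) u v w w' : 0 < h ->
  {within `[t0, t1], continuous u} -> {within `[t0, t1], continuous v} ->
  strongly_measurable `[t0, t1] w -> strongly_measurable `[t0, t1] w' ->
  mu.-integrable `[t0, t1] (EFin \o (fun t => `|w t|)) ->
  mu.-integrable `[t0, t1] (EFin \o (fun t => `|w' t|)) ->
  mu.-integrable `[t0, t1] (EFin \o (fun t => bracket h (u t - v t) (w t - w' t))).
Proof.
move=> h0 cu cv sw sw' iw iw'.
have mposnorm c : measurable_fun `[t0, t1] (fun t => posnorm (u t - v t + c)).
  apply: subspace_continuous_measurable_fun => //.
  exact: within_continuous_posnorm.
have cposnorm (p : X) (s : R) : continuous (fun x : X => posnorm (p + s *: x)).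
  move=> x; apply/cvgrPdist_le => e e0.
  have d0 : 0 < e / (`|s| + 1) by rewrite divr_gt0// ltr_wpDl.
  apply/nbhs_ballP; exists (e / (`|s| + 1)) => // y; rewrite -ball_normE /= => yx.
  apply: le_trans (posnorm_dist_le _ _) _.
  rewrite opprD addrACA subrr add0r -scalerBr normrZ.
  move: (ltW yx); rewrite ler_pdivlMr ?ltr_wpDl// mulrC mulrDl mul1r.
  by apply: le_trans; rewrite lerDl.
have m0 : measurable_fun `[t0, t1] (fun t => posnorm (u t - v t)).
  apply: subspace_continuous_measurable_fun => //.
  exact: within_continuous_posnormB.
(* The forcings are inserted one at a time: here the second is frozen at [c], and [m2] inserts
   it. *)
have m1 c : measurable_fun `[t0, t1]
    (fun t => posnorm (u t - v t + h *: w t + - h *: c)).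
  rewrite (_ : (fun t => _) =
      (fun t => posnorm (u t - v t + - h *: c + h *: w t))); last first.
    by apply/funext => t; rewrite addrAC.
  apply: (@measurable_fun_strong_comp R X _
    (fun t (x : X) => posnorm (u t - v t + - h *: c + h *: x)) w) => // c'.
  rewrite (_ : (fun t => _) =
      (fun t => posnorm (u t - v t + (- h *: c + h *: c')))); last first.
    by apply/funext => t; rewrite addrA.
  exact: mposnorm.
have m2 : measurable_fun `[t0, t1]
    (fun t => posnorm (u t - v t + h *: (w t - w' t))).
  rewrite (_ : (fun t => _) =
      (fun t => posnorm (u t - v t + h *: w t + - h *: w' t))); last first.
    by apply/funext => t; rewrite scalerBr addrA scaleNr.
  apply: (@measurable_fun_strong_comp R X _
    (fun t (x : X) => posnorm (u t - v t + h *: w t + - h *: x)) w') => //.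
have mb : measurable_fun `[t0, t1] (fun t => bracket h (u t - v t) (w t - w' t)).
  by apply: measurable_funM => //; exact: measurable_funB.
have := integrableD_EFin (measurable_itv _) iw iw'.
apply: le_integrable => //; first exact/measurable_EFinP.
move=> t _ /=; rewrite lee_fin [leRHS]ger0_norm ?addr_ge0//.
apply: le_trans (norm_bracket_le _ _ h0) _; exact: ler_normB.
Qed.

End mild_bracket.

(** * Growth of the positive part for two mild solutions *)

Section mild_comparison.
Context {R : realType} {X : banachLatticeType R}.
Local Notation mu := (@lebesgue_measure R).
Implicit Types (A : X -> set X) (u v w : R -> X).

(** The last hypothesis of [bracket_inequality] follows by integrating [bracket_le]: the base point
    moves by at most [2 * th], hence [4 * th / h]. *)
Lemma mild_bracket_inequality A (t0 t1 h : R) u v w wh w' wh' :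
  T_accretive A -> 0 < h ->
  {within `[t0, t1], continuous u} -> {within `[t0, t1], continuous v} ->
  forcing_version A t0 t1 w u w' -> forcing_version A t0 t1 wh v wh' ->
  forall a b, t0 <= a -> a <= b -> b <= t1 ->
    posnorm (u b - v b) <= posnorm (u a - v a) +
      \int[mu]_(t in `[a, b]) bracket h (u t - v t) (w' t - wh' t).
Proof.
move=> hA h0 cu cv [sw iw _ Su] [swh iwh _ Sv].
have ig := integrable_bracket h0 cu cv sw swh 
  (integrable_norm_of_dist iw) (integrable_norm_of_dist iwh).
apply: (bracket_inequality hA h0 (deviation_L1 iw) (deviation_L1 iwh) Su Sv
  (Gint := fun x y => \int[mu]_(t in `[x, y]) bracket h (u t - v t) (w' t - wh' t))).
- move=> eta eta0; have [r r0 ur] := within_continuous_itv_unif cu eta0.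
  have [q q0 vq] := within_continuous_itv_unif cv eta0.
  exists (Num.min r q); first by rewrite lt_min r0.
  move=> x y xI yI; rewrite le_min => /andP[xyr xyq].
  by split; [exact: ur|exact: vq].
- move=> x y z t0x xy yz zt1; apply: Rintegral_itv_cat => //.
  exact: integrable_itvS ig.
- move=> a b c c' th t0a ab bt1 osc.
  have ia (z : R -> X) p : mu.-integrable `[t0, t1] (EFin \o (fun t => `|z t - p|)) ->
      mu.-integrable `[a, b] (EFin \o (fun t => `|z t - p|)).
    exact: integrable_itvS.
  have iga := integrable_itvS t0a bt1 ig.
  have icst (r : R) : mu.-integrable `[a, b] (EFin \o (fun _ : R => r)).
    by apply: continuous_compact_integrable;
      [exact: segment_compact|exact: cst_continuous].
  have mI : measurable (`[a, b] : set R) by [].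
  have i1 := integrableD_EFin mI iga (icst (4 * th / h)).
  have i2 := integrableD_EFin mI i1 (ia _ _ (iw c)).
  have i3 := integrableD_EFin mI i2 (ia _ _ (iwh c')).
  rewrite -(Rintegral_itv_cst (4 * th / h) ab) /deviation mulrC.
  rewrite -(Rintegral_itv_cst _ ab) -RintegralD// -RintegralD//; last exact: ia.
  rewrite -RintegralD//; last exact: ia.
  apply: le_Rintegral => // t; rewrite /= in_itv => tab.
  have [uth vth] := osc _ tab.
  have pq : `|u a - v a - (u t - v t)| <= 2 * th.
    have -> : u a - v a - (u t - v t) = u a - u t - (v a - v t).
      by rewrite !opprB [v t - u t]addrC addrACA [- v a + _]addrC.
    apply: le_trans (ler_normB _ _) _.
    by move: uth vth; rewrite distrC [`|v t - _|]distrC; lra.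
  have zz : `|c - c' - (w' t - wh' t)| <= `|w' t - c| + `|wh' t - c'|.
    have -> : c - c' - (w' t - wh' t) = - (w' t - c) + (wh' t - c').
      by rewrite !opprB (AC (2*2) ((1*4)*(3*2))).
    by apply: le_trans (ler_normD _ _) _; rewrite normrN.
  have := bracket_le h0 pq zz; rewrite /bracket.
  by rewrite (_ : 2 * (2 * th) = 4 * th) ?addrA//; clear; lra.
Qed.

(** Quasimonotonicity for [x] and [vjoin x y] puts the vector [d] of the proof within [e * h] of a
    positive [q]. Subtracting [q] does not increase [posnorm], so only the increment of [F] from [y]
    to [vjoin x y] remains, which the Lipschitz bound controls. *)
Lemma quasimonotone_bracket (D : set X) (F : X -> X) (x y : X) (om : R) :
  quasimonotone D F -> D x -> D y -> D (vjoin x y) ->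
  `|F (vjoin x y) - F y| <= om * `|vjoin x y - y| ->
  forall e, 0 < e -> \forall h \near 0^'+,
    bracket h (x - y) (F x - F y) <= om * posnorm (x - y) + e.
Proof.
move=> qm Dx Dy Dj Fom e e0.
have /(_ _ (open_nbhs_nbhs _)) := qm x _ Dx Dj (vle_joinl x y).
move=> /(_ [set d | (d < e%:E)%E]) /= H.
have {}H : \forall h \near 0^'+, (h^-1%:E * edist_inf pos_cone
    (vjoin x y - x + h *: (F (vjoin x y) - F x))%R < e%:E)%E.
  by apply: H; split; [exact: open_ereal_lt_ereal|rewrite /= lte_fin].
near=> h.
have h0 : 0 < h by near: h; exact: nbhs_right_gt.
have : (h^-1%:E * edist_inf pos_cone
    (vjoin x y - x + h *: (F (vjoin x y) - F x))%R < e%:E)%E by near: h.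
rewrite lte_pdivrMl// -EFinM => /ereal_inf_lt[_ [q q0 <-]] /edist_lt_ball /=.
rewrite -ball_normE /=.
set d := vjoin x y - x + h *: (F (vjoin x y) - F x); move=> dq.
rewrite /bracket ler_pdivrMr//.
have -> : x - y + h *: (F x - F y) =
    pospart (x - y) + h *: (F (vjoin x y) - F y) + - (d - q) + - q.
  have subB (a b c : X) : (a - b) - (a - c) = c - b.
    by rewrite opprB addrC addrA subrK.
  rewrite -[RHS]addrA -opprD subrK -vjoinBr /d opprD addrACA -scalerBr.
  by rewrite !subB.
have := posnormD (pospart (x - y) + h *: (F (vjoin x y) - F y) + - (d - q)) (- q).
have -> : posnorm (- q) = 0 by apply/posnorm_eq0; rewrite -oppr0; exact: vle_opp.
have := posnormD (pospart (x - y) + h *: (F (vjoin x y) - F y)) (- (d - q)).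
have := posnorm_le_norm (- (d - q)); rewrite normrN.
have := posnormD (pospart (x - y)) (h *: (F (vjoin x y) - F y)).
have := posnorm_le_norm (h *: (F (vjoin x y) - F y)).
have := posnorm_le_norm (pospart (x - y)); rewrite -/(posnorm (x - y)).
move: Fom; rewrite vjoinBr -/(posnorm (x - y)) -(ler_pM2l h0).
rewrite normrZ gtr0_norm//.
lra.
Unshelve. all: by end_near. Qed.

(** The limit [h -> 0] in [mild_bracket_inequality], along [h n]. The pointwise bound concerns [w]
    and [wh], the integral their versions, which agree with them almost everywhere. *)
Lemma posnorm_growth A (t0 t1 s b m : R) (om : R -> R) u v w wh w' wh' :
  T_accretive A ->
  {within `[t0, t1], continuous u} -> {within `[t0, t1], continuous v} ->
  forcing_version A t0 t1 w u w' -> forcing_version A t0 t1 wh v wh' ->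
  t0 <= s -> s <= b -> b <= t1 ->
  mu.-integrable `[t0, t1] (EFin \o om) ->
  (forall t, t \in `[t0, t1] -> 0 <= om t) -> 0 <= m ->
  {ae mu, forall t, t \in `[s, b] -> forall e, 0 < e -> \forall h \near 0^'+,
    bracket h (u t - v t) (w t - wh t) <= m * om t + e} ->
  posnorm (u b - v b) <= posnorm (u s - v s) + m * \int[mu]_(t in `[s, b]) om t.
Proof.
move=> hA cu cv ver verh t0s sb bt1 iom om0 m0 aeb.
have [sw iw aew _] := ver; have [swh iwh aewh _] := verh.
have iw0 := integrable_norm_of_dist iw.
have iwh0 := integrable_norm_of_dist iwh.
pose h n : R := n.+1%:R^-1.
have h0 n : 0 < h n by rewrite invr_gt0.
have near_h (P : R -> Prop) : (\forall r \near 0^'+, P r) -> \forall n \near \oo, P (h n).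
  rewrite near_withinE => Pr.
  have : \forall n \near \oo, (0 < h n -> P (h n)) := @cvg_harmonic R _ Pr.
  by apply: filterS => n; apply; exact: (h0 n).
pose g n t := bracket (h n) (u t - v t) (w' t - wh' t).
have ig n : mu.-integrable `[s, b] (EFin \o g n).
  by apply: (integrable_itvS t0s bt1); exact: integrable_bracket.
have iomb := integrable_itvS t0s bt1 iom.
have mI : measurable (`[s, b] : set R) by [].
have imom : mu.-integrable `[s, b] (EFin \o (fun t => m * om t)).
  have : mu.-integrable `[s, b] (fun t => m%:E * (EFin \o om) t)%E.
    exact: integrableZl.
  exact.
(* [g n] is only bounded above by [m * om + o(1)], so dominated convergence is
   applied to the positive part of the excess. *)
pose f n t := Num.max (g n t - m * om t) 0.
have mf n : measurable_fun `[s, b] (f n).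
  apply: measurable_maxr; last exact: measurable_cst.
  apply: measurable_funB; apply/measurable_EFinP; exact: (measurable_int mu).
have iW := integrable_itvS t0s bt1 (integrableD_EFin (measurable_itv _) iw0 iwh0).
have fW n t : t \in `[s, b] -> `|f n t| <= `|w' t| + `|wh' t|.
  move=> tsb; rewrite /f ger0_norm ?le_max ?lexx ?orbT// ge_max addr_ge0// andbT.
  have om_t : 0 <= m * om t.
    rewrite mulr_ge0// om0//; move: tsb; rewrite !in_itv/= => /andP[st tb].
    by rewrite (le_trans t0s)//= (le_trans tb).
  have := norm_bracket_le (u t - v t) (w' t - wh' t) (h0 n).
  rewrite -/(g n t) => /(le_trans (ler_norm _)).
  by have := ler_normB (w' t) (wh' t); lra.
have if_ n : mu.-integrable `[s, b] (EFin \o f n).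
  apply: le_integrable iW => //; first by apply/measurable_EFinP; exact: mf.
  move=> t tsb; rewrite /= lee_fin [leRHS]ger0_norm ?addr_ge0//.
  exact: fW.
have [|||||_ _] := @dominated_convergence _ _ _ mu `[s, b] mI
  (fun n => EFin \o f n) (cst 0%E) (EFin \o (fun t => `|w' t| + `|wh' t|)).
- by move=> n; apply/measurable_EFinP; exact: mf.
- exact: measurable_cst.
- move: aew aewh aeb.
  apply: (@filterS3 _ _ (ae_filter_ringOfSetsType mu)) => t Hw Hwh Hb tsb.
  have t01 : t \in `[t0, t1].
    move: tsb; rewrite /= !in_itv/= => /andP[st tb].
    by rewrite (le_trans t0s)//= (le_trans tb).
  apply: cvg_EFin; first exact: nearW.
  apply/cvgrPdist_le => e e0; have := near_h _ (Hb tsb e e0).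
  apply: filterS => n hbn; rewrite /= sub0r normrN ger0_norm; last first.
    by rewrite /f le_max lexx orbT.
  rewrite /f ge_max (ltW e0) andbT /g (Hw t01) (Hwh t01) lerBlDl.
  exact: hbn.
- exact: iW.
- apply: aeW => t n tsb; rewrite /= lee_fin; exact: fW.
have -> : (\int[mu]_(x in `[s, b]) cst 0 x = 0)%E by rewrite integral0.
move=> /fine_cvg intf.
apply/ler_addgt0Pr => e e0.
have [n fne] := filter_ex (cvgr_lt _ intf _ e0).
have := mild_bracket_inequality hA (h0 n) cu cv ver verh t0s sb bt1.
rewrite -/(g n).
have : \int[mu]_(t in `[s, b]) g n t <= \int[mu]_(t in `[s, b]) (m * om t + f n t).
  apply: le_Rintegral => //; first exact: integrableD_EFin.
  by move=> t _; rewrite -lerBlDl /f le_max lexx.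
rewrite RintegralD// RintegralZl//.
move: fne; rewrite /= -/(Rintegral _ _ _); lra.
Qed.

End mild_comparison.

(** * Propagation to the right of a zero of the positive part *)

Section comparison_principle.
Context {R : realType} {X : banachLatticeType R}.
Local Notation mu := (@lebesgue_measure R).

(** Gronwall by absorption: on a short interval the integral of [om] is at most [1 / 2], so the
    maximum [m] of the positive part satisfies [m <= m / 2]. *)
Lemma posnorm_zero_right (A : X -> set X) (t0 t1 s : R) (K : R -> set X)
    (f : R -> X -> X) (u v : R -> X) :
  T_accretive A ->
  (forall t, t \in `[t0, t1] -> forall x y : X,
    tube A K t x -> tube A K t y -> tube A K t (vjoin x y)) ->
  locally_lipschitz_in_state A K t0 t1 f ->
  {ae mu, forall t, t \in `[t0, t1] -> quasimonotone (tube A K t) (f t)} ->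
  mild_solution_in_tube A K t0 t1 f u -> mild_solution_in_tube A K t0 t1 f v ->
  t0 <= s < t1 -> posnorm (u s - v s) = 0 ->
  exists2 d, 0 < d & forall t, s <= t <= s + d -> t <= t1 ->
    posnorm (u t - v t) = 0.
Proof.
move=> hA hK hlip hqm [cu tu _ mu_] [cv tv _ mv] /andP[t0s st1] us0.
have [w' ver] := forcing_version_exists mu_.
have [wh' verh] := forcing_version_exists mv.
(* The ball is centred at [v s], which is the join of [u s] and [v s]. While [u] and [v] move by at
   most [r / 4], the positive part is at most [r / 2] and the join stays within [3 * r / 4] of the
   centre. *)
have [r [om [r0 om0 iom lip]]] := hlip (v s).
have r4 : 0 < r / 4 by rewrite divr_gt0.
have [d1 d10 ud] := within_continuous_itv_unif cu r4.
have [d2 d20 vd] := within_continuous_itv_unif cv r4.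
have iom' : mu.-integrable `[s, t1] (EFin \o om).
  exact: integrable_itvS t0s (lexx _) iom.
have [d3 d30 omd] : exists2 d, 0 < d & forall y, s <= y <= t1 -> y - s < d ->
    \int[mu]_(t in `[s, y]) om t <= 1 / 2.
  have /within_continuousP cont := parameterized_integral_continuous (ltW st1) iom'.
  have half : 0 < 1 / 2 :> R by rewrite divr_gt0.
  have ss : `[s, t1]%classic s by rewrite /= in_itv/= lexx ltW.
  have [d d0 dP] := cont _ ss _ half; exists d => // y /andP[sy yt1] ysd.
  have := dP y; rewrite /= in_itv/= sy yt1 => /(_ isT).
  rewrite (ger0_norm (_ : 0 <= y - s)) ?subr_ge0// => /(_ ysd)/ltW.
  rewrite [X in _ - X](_ : _ = 0); last first.
    by rewrite /parameterized_integral set_itv1 Rintegral_set1.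
  by rewrite subr0 => /(le_trans (ler_norm _)).
pose d := Num.min (Num.min d1 d2) (d3 / 2).
have d0 : 0 < d by rewrite !lt_min d10 d20 divr_gt0.
have dd1 : d <= d1 by rewrite !ge_min lexx.
have dd2 : d <= d2 by rewrite !ge_min lexx orbT.
have dd3 : d < d3.
  have : d <= d3 / 2 by rewrite !ge_min lexx orbT.
  by move: d30; clear; lra.
exists d => // t /andP[st tsd] tt1.
have sub (x : R) : s <= x <= t -> t0 <= x <= t1.
  by move=> /andP[sx xt]; rewrite (le_trans t0s sx) (le_trans xt tt1).
have cphi : {within `[s, t], continuous (fun x => posnorm (u x - v x))}.
  apply: continuous_subspaceW (within_continuous_posnormB cu cv).
  by move=> x /=; rewrite !in_itv/=; exact: sub.
(* The growth estimate is applied up to the maximum point [c], so that [m] appears on both sides. *)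
have [c] := EVT_max st cphi; rewrite in_itv/= => /andP[sc ct] cmax.
set m := posnorm (u c - v c) in cmax.
suff m0 : m <= 0.
  apply: le_anti; rewrite posnorm_ge0 andbT; apply: le_trans m0.
  by apply: cmax; rewrite in_itv/= st lexx.
have : m <= posnorm (u s - v s) + m * \int[mu]_(t in `[s, c]) om t.
  apply: (posnorm_growth hA cu cv ver verh t0s sc (le_trans ct tt1) iom om0) => //.
    exact: posnorm_ge0.
  move: hqm lip; apply: (@filterS2 _ _ (ae_filter_ringOfSetsType mu)) => x qm lip.
  rewrite in_itv/= => /andP[sx xc].
  have xst : s <= x <= t by rewrite sx (le_trans xc).
  have xI : x \in `[t0, t1] by rewrite in_itv/= sub.
  have sI : t0 <= s <= t1 by rewrite t0s ltW.
  have xs_d : `|x - s| <= d.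
    by rewrite ger0_norm ?subr_ge0// lerBlDl; case/andP: xst => _ /le_trans; exact.
  have ux := ud x s (sub _ xst) sI (le_trans xs_d dd1).
  have vx := vd x s (sub _ xst) sI (le_trans xs_d dd2).
  have tj := hK x xI _ _ (tu x xI) (tv x xI).
  have phx : posnorm (u x - v x) <= r / 2.
    have := posnormB_le (u x) (v x) (u s) (v s); rewrite us0.
    by move: ux vx; clear; lra.
  have lip_x : `|f x (vjoin (u x) (v x)) - f x (v x)| <=
      om x * `|vjoin (u x) (v x) - v x|.
    apply: (lip xI); split.
    - exact: tj.
    - rewrite closed_ballE// /closed_ball_ /= distrC.
      apply: le_trans (ler_distD (v x) _ _) _.
      rewrite vjoinBr -/(posnorm _).
      by move: phx vx; clear -r0; lra.
    - exact: tv.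
    - rewrite closed_ballE// /closed_ball_ /= distrC.
      by move: vx; clear -r0; lra.
  move=> e e0; have := quasimonotone_bracket (qm xI) (tu x xI) (tv x xI) tj lip_x e0.
  apply: filterS => h /le_trans; apply; rewrite lerD2r mulrC ler_wpM2r ?om0//.
  by apply: cmax; rewrite in_itv.
have m_ge0 : 0 <= m by exact: posnorm_ge0.
have : m * \int[mu]_(t in `[s, c]) om t <= m * (1 / 2).
  rewrite ler_wpM2l// omd ?sc ?(le_trans ct)//.
  by apply: le_lt_trans dd3; rewrite lerBlDl (le_trans ct).
by rewrite us0; clear; lra.
Qed.

End comparison_principle.

Theorem theorem10p2 (R : realType) (X : banachLatticeType R)
    (A : X -> set X) (hA : m_T_accretive A)
    (t0 t1 : R) (ht : t0 <= t1) (K : R -> set X)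
    (hK : forall t, t \in `[t0, t1] -> forall x y : X,
      tube A K t x -> tube A K t y -> tube A K t (vjoin x y))
    (f : R -> X -> X)
    (hlip : locally_lipschitz_in_state A K t0 t1 f)
    (hqm : {ae (@lebesgue_measure R), forall t, t \in `[t0, t1] ->
      quasimonotone (tube A K t) (f t)})
    (u v : R -> X)
    (hu : mild_solution_in_tube A K t0 t1 f u)
    (hv : mild_solution_in_tube A K t0 t1 f v)
    (huv : vle (u t0) (v t0)) :
  forall t, t \in `[t0, t1] -> vle (u t) (v t).
Proof.
move=> t; rewrite in_itv/= => /andP[t0t tt1]; apply/vle_posnormB.
have [//|phit] := eqVneq (posnorm (u t - v t)) 0; exfalso.
have [_ hAT] := hA; have [cu _ _ _] := hu; have [cv _ _ _] := hv.
(* [S] lies to the left of [t], where the comparison is assumed to fail; a zero to the right of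
   [sup S] gives the contradiction. *)
pose S := [set x | t0 <= x <= t /\ posnorm (u x - v x) = 0].
have St0 : S t0 by split; [rewrite lexx|exact/vle_posnormB].
have ubS : ubound S t by move=> x [/andP[]].
have supS : has_sup S by split; [exists t0|exists t].
have t0s : t0 <= sup S by apply: ub_le_sup => //; exists t.
have st : sup S <= t by apply: ge_sup => //; exists t0.
have us0 : posnorm (u (sup S) - v (sup S)) = 0.
  (* By continuity a positive value at [sup S] would persist nearby, yet elements of [S] lie
     arbitrarily close to [sup S]. *)
  apply/eqP; apply/negPn/negP => us.
  have us_gt0 : 0 < posnorm (u (sup S) - v (sup S)) by rewrite lt_neqAle eq_sym us posnorm_ge0.
  have /within_continuousP/(_ (sup S)) := within_continuous_posnormB cu cv.
  rewrite /= in_itv/= t0s (le_trans st tt1) => /(_ isT _ us_gt0)[d d0 dP].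
  have [x [/andP[t0x xt] ux0] xs] := sup_adherent d0 supS.
  have xS : x <= sup S by apply: ub_le_sup => //; [exists t|split; rewrite ?t0x].
  have := dP x; rewrite /= in_itv/= t0x (le_trans xt tt1) => /(_ isT).
  rewrite ux0 sub0r normrN distrC ger0_norm ?subr_ge0// ltrBlDr -ltrBlDl.
  by rewrite ltrBlDr addrC -ltrBlDl => /(_ xs); rewrite ger0_norm ?ltxx// ltW.
have s_lt_t : sup S < t.
  by rewrite lt_neqAle st andbT; apply: contraNneq phit => <-; rewrite us0.
have sI : t0 <= sup S < t1 by rewrite t0s (lt_le_trans s_lt_t).
have [d d0 dP] := posnorm_zero_right hAT hK hlip hqm hu hv sI us0.
pose x := Num.min (sup S + d) t.
have sx : sup S < x by rewrite lt_min s_lt_t andbT ltrDl.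
have xt : x <= t by rewrite ge_min lexx orbT.
have Sx : S x.
  split; first by rewrite xt (le_trans t0s) ?ltW.
  by apply: dP; [rewrite ltW//= ge_min lexx|exact: le_trans tt1].
have : x <= sup S by apply: ub_le_sup => //; exists t.
by rewrite leNgt sx.
Qed.
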